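(* For $f\in\mathcal{S}(\mathbb{R}^2;E^2(2))$ the following are equivalent: (a) The elastic ray transform of $f$ vanishes, i.e. $X^2f(x,\xi,\zeta)=0$ for all $(x,\xi,\zeta)\in\mathbb{R}^2\times\mathcal{Z}$. (b) There are $v\in C^\infty(\mathbb{R}^2;E^1(2))$ and $u\in C^\infty(\mathbb{R}^2;\mathbb{R}^2)$ such that $u$ and $v$ and all their partial derivatives tend to $0$ as $|x|\to\infty$, and $f=Hv+Ku$.
   Context: $E^1(n)=S^2(\mathbb{R}^n)$ is the space of symmetric $2$-tensors on $\mathbb{R}^n$. $E^2(n)$ is the space of elastic $2$-tensors: $4$-tensors $w=(w_{ijkl})$ on $\mathbb{R}^n$ with $w_{ijkl}=w_{jikl}=w_{ijlk}=w_{klij}$. $C^\infty(\mathbb{R}^n;V)$ and $\mathcal{S}(\mathbb{R}^n;V)$ denote the $V$-valued tensor fields with smooth, respectively Schwartz, components. For smooth $v$ with values in $E^1(n)$ and smooth $u$ with values in $\mathbb{R}^n$, define $$(Hv)_{ijkl}=\tfrac12\left(\frac{\partial^2v_{kl}}{\partial x_i\partial x_j}+\frac{\partial^2v_{ij}}{\partial x_k\partial x_l}\right),\qquad (Ku)_{ijkl}=\tfrac14\left(\frac{\partial u_j}{\partial x_i}+\frac{\partial u_i}{\partial x_j}\right)\delta_{kl}+\tfrac14\left(\frac{\partial u_k}{\partial x_l}+\frac{\partial u_l}{\partial x_k}\right)\delta_{ij},$$ where $\delta_{ij}$ is the Kronecker delta. Let $\mathcal{Z}=\{(\xi,\zeta):\xi\in\mathbb{S}^{n-1},\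 \zeta\in\mathbb{R}\xi\cup\xi^\perp\}$, where $\xi^\perp$ is the hyperplane through the origin orthogonal to $\xi$ (here $n=2$). The elastic ray transform of $f\in\mathcal{S}(\mathbb{R}^n;E^2(n))$ is $$X^2f(x,\xi,\zeta)=\int_{\mathbb{R}}\langle f(x+t\xi),(\xi\otimes\zeta)^{\otimes2}\rangle\,dt=\int_{\mathbb{R}}\sum_{i,j,k,l=1}^n f_{ijkl}(x+t\xi)\,\xi_i\zeta_j\xi_k\zeta_l\,dt,\qquad (x,\xi,\zeta)\in\mathbb{R}^n\times\mathcal{Z}.$$ *)

(* Defs.v *)
From HB Require Import structures.
From mathcomp Require Import all_boot all_order all_algebra.
From mathcomp Require Import all_classical all_reals all_analysis.

Set Implicit Arguments.
Unset Strict Implicit.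
Unset Printing Implicit Defensive.

Import Order.TTheory GRing.Theory Num.Theory.
Import numFieldNormedType.Exports.

Local Open Scope classical_set_scope.
Local Open Scope ring_scope.

Section ScalarFields.
Context {R : realType} {n : nat}.
Implicit Types (g : 'rV[R]_n -> R) (x y : 'rV[R]_n).

(* The library norm on ['rV[R]_n] is the sup norm, and its dot product of row
   vectors is only available over complex scalars. *)
Definition dotv x y : R := \sum_(i < n) x 0 i * y 0 i.

Definition enorm x : R := Num.sqrt (dotv x x).

Definition partial (i : 'I_n) g : 'rV[R]_n -> R :=
  fun x => 'D_(delta_mx 0 i) g x.

(* [partials [:: i1; ..; ik] g] is d_i1 (d_i2 (.. (d_ik g))); ranging over all
   sequences gives the partial derivatives of all orders, including [g]. *)
Definition partials (s : seq 'I_n) g : 'rV[R]_n -> R := foldr partial g s.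

Definition smooth g : Prop :=
  forall s : seq 'I_n,
    continuous (partials s g) /\
    (forall (i : 'I_n) x, derivable (partials s g) x (delta_mx 0 i)).

Definition schwartz g : Prop :=
  smooth g /\
  forall (a : 'I_n -> nat) (s : seq 'I_n),
    exists C : R, forall x, `|(\prod_(i < n) x 0 i ^+ a i) * partials s g x| <= C.

Definition tends_to_0_at_infinity g : Prop :=
  forall e : R, 0 < e -> exists M : R, forall x, M < enorm x -> `|g x| < e.

Definition vanishing_derivatives g : Prop :=
  forall s : seq 'I_n, tends_to_0_at_infinity (partials s g).

End ScalarFields.

Section Tensors.
Variables (R : realType) (n : nat).

Definition tensor4 := 'I_n -> 'I_n -> 'I_n -> 'I_n -> R.

Definition symmetric2 (v : 'M[R]_n) : Prop := forall i j, v i j = v j i.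

Definition elastic2 (w : tensor4) : Prop :=
  forall i j k l, [/\ w i j k l = w j i k l, w i j k l = w i j l k
                    & w i j k l = w k l i j].

End Tensors.

Section Operators.
Context {R : realType} {n : nat}.

Definition H (v : 'rV[R]_n -> 'M[R]_n) : 'rV[R]_n -> tensor4 R n :=
  fun x i j k l =>
    2^-1 * (partial i (partial j (fun y => v y k l)) x
            + partial k (partial l (fun y => v y i j)) x).

Definition K (u : 'rV[R]_n -> 'rV[R]_n) : 'rV[R]_n -> tensor4 R n :=
  fun x i j k l =>
    4^-1 * (partial i (fun y => u y 0 j) x + partial j (fun y => u y 0 i) x)
      * (k == l)%:R
    + 4^-1 * (partial l (fun y => u y 0 k) x + partial k (fun y => u y 0 l) x)
      * (i == j)%:R.

Definition admissible (xi zeta : 'rV[R]_n) : Prop :=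
  enorm xi = 1 /\ ((exists c : R, zeta = c *: xi) \/ dotv xi zeta = 0).

Definition elastic_ray_transform (f : 'rV[R]_n -> tensor4 R n)
    (x xi zeta : 'rV[R]_n) : R :=
  \int[@lebesgue_measure R]_t
    (\sum_(i < n) \sum_(j < n) \sum_(k < n) \sum_(l < n)
       f (x + t *: xi) i j k l * xi 0 i * zeta 0 j * xi 0 k * zeta 0 l).

End Operators.

(* Main.v *)
Require Import Defs.
From HB Require Import structures.
From mathcomp Require Import all_boot all_order all_algebra.
From mathcomp Require Import all_classical all_reals all_analysis.
From mathcomp Require Import measurable_realfun ring lra.

Set Implicit Arguments.
Unset Strict Implicit.
Unset Printing Implicit Defensive.

Import Order.TTheory GRing.Theory Num.Theory.
Import numFieldNormedType.Exports.

Local Open Scope classical_set_scope.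
Local Open Scope ring_scope.

(** For a unit vector [xi], write [rot xi] for its rotation by a right angle,
    [p = xi_0 xi_1] and [m = xi_0^2 - xi_1^2], and name the components of [f]
      [a = f_0000], [b = f_0001], [c = f_0011],
      [d = f_0101], [e = f_0111], [g = f_1111].
    The transform of [f] vanishes when, for every [xi], the lines in the
    direction [xi] integrate to zero both the pressure part [P] (pairing with
    [zeta = xi]) and the shear part [S] (pairing with [zeta = rot xi]), where
      [S = (a + g - 2 c) p^2 + 2 (e - b) p m + d m^2],
      [P + S = (a + d) xi_0^2 + 2 (b + e) p + (g + d) xi_1^2].

    Potentials have zero transform ([potential_null]): if [f = H v + K u], then
    for admissible [xi] and [zeta] the integrand is the derivative along the ray
    of the function [d_zeta v(xi, zeta) + <xi, zeta> <u, zeta>], which tends to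
    zero at both ends ([along_ray_potential]).

    For the other implication, look for a trace-free [v] with diagonal entries
    [- s / 2], [s / 2] and off-diagonal entry [t], and put [w = u + div v].
    Then [f = H v + K u] amounts to six scalar equations
    ([elastic_decomposition]):
      [d_0 d_1 t = d], [d_1^2 s - d_0^2 s = a + g - 2 c],
      [d_0 w_0 = a + d], [d_1 w_1 = g + d],
      [d_1^2 t - d_0^2 t + d_0 d_1 s = 2 (e - b)],
      [d_0 w_1 + d_1 w_0 = 2 (b + e)].
    The first four are solved by integrating along half-lines: a rapidly
    decreasing function whose line integrals in the direction [e] vanish is the
    derivative along [e] of a rapidly decreasing function, and this
    antiderivative inherits the vanishing of the line integrals in the orthogonal
    direction ([antiderivative]). The vanishing needed here is that of [S] along
    the axes and the diagonals, and of [P] along the axes. For the last two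
    equations, let [r] be the difference of the two sides. Subtracting
    [d_xi d_(rot xi) (p s + m t)] from [S] leaves [p m r], and subtracting
    [d_xi <xi, w>] from [P + S] leaves [p r]; derivatives along [xi] have zero
    line integrals in the direction [xi], so those of [r] vanish in every
    direction off the axes and the diagonals. Hence [r = 0] by the injectivity
    of the Radon transform ([ray_injective]).

    Injectivity is proved by averaging. The function
    [k(m, b) = Re ((1 + |m| - i b)^-2)] of a line with slope [m] and offset [b]
    is chosen so that its integral over the lines through [(x, y)] is
    [2 / ((1 + x^2) (1 + y^2))] ([Rintegral_radon_kernel]). If almost every
    slope gives lines with zero integrals, Fubini shows that the function is
    orthogonal to this weight ([radon_average]); rescaling around a point turns
    the weight into an approximate identity ([radon_injective]). *)

(** * Integrals of continuous functions dominated by the Cauchy weight *)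

Section CauchyWeight.
Context {R : realType}.
Implicit Types (f F : R -> R) (C t : R).
Local Notation mu := (@lebesgue_measure R).

(** The weight [1 / (1 + t^2)]. *)
Definition cauchyw t : R := (oneDsqr t)^-1.

Lemma cauchyw_gt0 t : 0 < cauchyw t.
Proof. by rewrite invr_gt0. Qed.

Lemma cauchyw_ge0 t : 0 <= cauchyw t.
Proof. exact/ltW/cauchyw_gt0. Qed.

Lemma cauchyw_le1 t : cauchyw t <= 1.
Proof. exact: oneDsqrV_le1. Qed.

Lemma cauchywN t : cauchyw (- t) = cauchyw t.
Proof. by rewrite /cauchyw /oneDsqr sqrrN. Qed.

Lemma continuous_cauchyw : continuous cauchyw.
Proof. exact: continuous_oneDsqrV. Qed.

Lemma is_derive_atan t : is_derive t 1 atan (cauchyw t).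
Proof. exact: is_derive1_atan. Qed.

Lemma integrable_cauchyw : mu.-integrable setT (EFin \o cauchyw).
Proof.
apply/integrableP; split.
  apply/measurable_EFinP; apply: continuous_measurable_fun.
  exact: continuous_cauchyw.
under eq_integral do rewrite /= ger0_norm ?cauchyw_ge0//.
rewrite ge0_symfun_integralT//; [|exact: cauchyw_ge0|exact: continuous_cauchyw|].
  by rewrite -set_itvcy integral0y_oneDsqr -EFinM ltry.
by move=> t /=; rewrite cauchywN.
Qed.

Lemma Rintegral_cauchyw_half : \int[mu]_(t in `[0, +oo[) cauchyw t = pi / 2.
Proof. by rewrite /Rintegral integral0y_oneDsqr. Qed.

Lemma Rintegral_cauchyw : \int[mu]_t cauchyw t = pi.
Proof.
rewrite /Rintegral ge0_symfun_integralT//; [|exact: cauchyw_ge0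
  |exact: continuous_cauchyw|by move=> t /=; rewrite cauchywN].
by rewrite -set_itvcy integral0y_oneDsqr -EFinM/= mulrC divfK.
Qed.

(** Continuous functions on the line bounded by a multiple of the weight. *)
Definition cauchy_dominated f : Prop :=
  continuous f /\ exists C, forall t, `|f t| <= C * cauchyw t.

Lemma cauchy_dominated_integrable (D : set R) f :
  measurable D -> cauchy_dominated f -> mu.-integrable D (EFin \o f).
Proof.
move=> mD [cf [C fC]]; apply: (@integrableS _ _ _ mu setT D (EFin \o f) measurableT mD (@subsetT _ D)).
have ig := @integrableZl _ _ _ mu setT measurableT C _ integrable_cauchyw.
apply: (le_integrable _ _ _ ig) => //.
- by apply/measurable_EFinP; exact: continuous_measurable_fun.
- by move=> t _ /=; rewrite lee_fin (le_trans (fC t))// ler_norm.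
Qed.

Lemma cauchy_dominatedN f :
  cauchy_dominated f -> cauchy_dominated (fun t => f (- t)).
Proof.
move=> [cf [C fC]]; split.
  by move=> x; apply: continuous_comp; [exact: oppr_continuous|exact: cf].
by exists C => t; rewrite -cauchywN.
Qed.

Lemma cauchy_dominatedD f g : cauchy_dominated f -> cauchy_dominated g ->
  cauchy_dominated (fun t => f t + g t).
Proof.
move=> [cf [C fC]] [cg [D gD]]; split; first by move=> x; apply: cvgD; [exact: cf|exact: cg].
by exists (C + D) => t; rewrite mulrDl (le_trans (ler_normD _ _))// lerD.
Qed.

Lemma cauchy_dominatedZ k f : cauchy_dominated f -> cauchy_dominated (fun t => k * f t).
Proof.
move=> [cf [C fC]]; split; first by move=> x; apply: cvgM; [exact: cvg_cst|exact: cf].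
by exists (`|k| * C) => t; rewrite normrM -mulrA ler_wpM2l.
Qed.

Lemma cauchy_dominated_cauchyw : cauchy_dominated cauchyw.
Proof.
split; first exact: continuous_cauchyw.
by exists 1 => t; rewrite mul1r ger0_norm ?cauchyw_ge0.
Qed.

(** A dominated function becomes nonnegative after adding a multiple of the
    weight; this reduces statements about integrals to nonnegative integrands. *)
Lemma cauchy_dominated_shift f : cauchy_dominated f ->
  exists C, forall t, 0 <= f t + C * cauchyw t.
Proof.
move=> [cf [C fC]]; exists C => t.
by have := fC t; rewrite ler_norml => /andP[? _]; lra.
Qed.

(** Fundamental theorem of calculus on a half-line, for integrands of
    arbitrary sign. *)
Lemma Rintegral_cauchy_dominated f F (l : R) : cauchy_dominated f ->
  (forall t, 0 <= t -> is_derive t 1 F (f t)) ->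
  F t @[t --> +oo] --> l ->
  \int[mu]_(t in `[0, +oo[) f t = l - F 0.
Proof.
move=> df dF Fl; have [C fC] := cauchy_dominated_shift df.
have [cf _] := df.
have iw : mu.-integrable `[0, +oo[ (EFin \o (fun t => C * cauchyw t)).
  by apply: cauchy_dominated_integrable => //; exact/cauchy_dominatedZ/cauchy_dominated_cauchyw.
have ifd := cauchy_dominated_integrable (measurable_itv `[0, +oo[) df.
have cF : F x @[x --> 0^'+] --> F 0.
  apply: cvg_at_right_filter; apply/differentiable_continuous/derivable1_diffP.
  by have := dF 0 (lexx 0); case.
have E1 : \int[mu]_(t in `[0, +oo[) (f t + C * cauchyw t) = (l + C * (pi / 2)) - (F 0 + C * atan 0).
  have dG t : 0 <= t -> is_derive t 1 (fun t => F t + C * atan t) (f t + C * cauchyw t).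
    by move=> /dF dFt; apply: is_deriveD; exact: (is_deriveZ C (is_derive_atan t)).
  apply: (@Rintegral_ge0_continuous_FTC2y _ (fun t => f t + C * cauchyw t) (fun t => F t + C * atan t)).
  - by move=> x _; exact: fC.
  - apply: continuous_subspaceT.
    have [] := cauchy_dominatedD df (cauchy_dominatedZ C cauchy_dominated_cauchyw).
    by [].
  - by apply: cvgD => //; apply: cvgM; [exact: cvg_cst|exact: cvgy_atan].
  - by move=> x /ltW/dG; case.
  - apply: cvgD => //; apply: cvgM; first exact: cvg_cst.
    by apply: cvg_at_right_filter; exact: continuous_atan.
  - move=> x; rewrite in_itv/= andbT derive1E => /ltW/dG dGx; exact: (@derive_val _ _ _ _ _ _ _ dGx).
move: E1; rewrite RintegralD// RintegralZl//; last first.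
  exact: cauchy_dominated_integrable cauchy_dominated_cauchyw.
by rewrite Rintegral_cauchyw_half atan0; lra.
Qed.

Lemma Rintegral_setT_half f : cauchy_dominated f ->
  \int[mu]_t f t = \int[mu]_(t in `[0, +oo[) (f t + f (- t)).
Proof.
have H0 (g : R -> R) : continuous g -> (forall t, 0 <= g t) -> mu.-integrable setT (EFin \o g) ->
   \int[mu]_t g t = \int[mu]_(t in `[0, +oo[) g t + \int[mu]_(t in `[0, +oo[) g (- t).
  move=> cg g0 ig.
  have ig' (D : set R) : measurable D -> mu.-integrable D (EFin \o g).
    by move=> mD; apply: (@integrableS _ _ _ _ setT).
  rewrite -(setUv `[0%R, +oo[%classic) Rintegral_setU//=; last 3 first.
  - exact: measurableC.
  - by rewrite setUv.
  - exact/disj_setPCl.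
  congr (_ + _); rewrite setCitvr Rintegral_itv_bndo_bndc; last exact: ig'.
  rewrite /Rintegral -{1}oppr0 ge0_integration_by_substitutionNy//.
  exact: continuous_subspaceT.
move=> df; have [C fC] := cauchy_dominated_shift df.
have iw : cauchy_dominated (fun t => C * cauchyw t) by exact/cauchy_dominatedZ/cauchy_dominated_cauchyw.
have := H0 (fun t => f t + C * cauchyw t) (cauchy_dominatedD df iw).1 fC.
move=> /(_ (cauchy_dominated_integrable measurableT (cauchy_dominatedD df iw))).
have i := cauchy_dominated_integrable (measurable_itv `[0, +oo[).
have iT := cauchy_dominated_integrable (@measurableT _ R).
rewrite RintegralD//; [|exact: iT|exact: iT].
rewrite RintegralD//; [|exact: i|exact: i].
under [X in _ + _ + X]eq_Rintegral do rewrite cauchywN.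
rewrite RintegralD//; [|exact/i/cauchy_dominatedN|exact: i].
rewrite RintegralD//; [|exact: i|exact/i/cauchy_dominatedN].
suff -> : \int[mu]_t (C * cauchyw t) =
    \int[mu]_(x in `[0, +oo[) (C * cauchyw x) + \int[mu]_(x in `[0, +oo[) (C * cauchyw x).
  by rewrite addrACA; exact: addIr.
rewrite !RintegralZl//; [|exact/i/cauchy_dominated_cauchyw|exact/iT/cauchy_dominated_cauchyw].
rewrite (H0 cauchyw); [|exact: continuous_cauchyw|exact: cauchyw_ge0|exact: integrable_cauchyw].
by under [X in _ * (_ + X)]eq_Rintegral do rewrite cauchywN; rewrite mulrDr.
Qed.

(** Fundamental theorem of calculus on the line, for a primitive vanishing at
    both ends. *)
Lemma Rintegral_setT_eq0 f F : cauchy_dominated f ->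
  (forall t, is_derive t 1 F (f t)) ->
  F t @[t --> +oo] --> (0 : R) -> F t @[t --> -oo] --> (0 : R) ->
  \int[mu]_t f t = 0.
Proof.
move=> df dF Fy FNy; rewrite Rintegral_setT_half//.
have i := cauchy_dominated_integrable (measurable_itv `[0, +oo[).
rewrite RintegralD//; [|exact: i|exact/i/cauchy_dominatedN].
rewrite (Rintegral_cauchy_dominated df (fun t _ => dF t) Fy).
have -> : \int[mu]_(t in `[0, +oo[) f (- t) = 0 - - F (- 0); last first.
  by rewrite oppr0; lra.
apply: (@Rintegral_cauchy_dominated (fun t => f (- t)) (fun t => - F (- t))).
- exact: cauchy_dominatedN.
- move=> t _; have dN := @is_deriveNid R R^o t 1.
  have dFt := dF (- t).
  have := is_deriveN (is_derive1_comp dFt dN).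
  by rewrite mulrN1 opprK.
- rewrite -oppr0; apply: cvgN; exact/cvgNy_compNP.
Qed.

Lemma cauchyw_shift c t : cauchyw (t + c) <= 2 * oneDsqr c * cauchyw t.
Proof.
rewrite ler_pdivlMr// mulrC ler_pdivrMr// /oneDsqr.
have := sqr_ge0 (t + c + c); have := sqr_ge0 (c * (t + c)).
by rewrite !exprMn; lra.
Qed.

Lemma cauchy_dominated_translation f c :
  cauchy_dominated f -> cauchy_dominated (fun t => f (t + c)).
Proof.
move=> [cf [C fC]]; split.
  move=> x; apply: continuous_comp; last exact: cf.
  by apply: cvgD; [exact: cvg_id|exact: cvg_cst].
exists (C * (2 * oneDsqr c)) => t; rewrite (le_trans (fC _))// -mulrA.
have C0 : 0 <= C.
  by rewrite -(pmulr_lge0 _ (cauchyw_gt0 t)) (le_trans _ (fC t)).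
by rewrite ler_wpM2l// cauchyw_shift.
Qed.

Lemma Rintegral_translation f c : cauchy_dominated f ->
  \int[mu]_t f (t + c) = \int[mu]_t f t.
Proof.
have H0 (g : R -> R) : continuous g -> (forall t, 0 <= g t) ->
    \int[mu]_t g (t + c) = \int[mu]_t g t.
  move=> cg g0.
  have dS : ((shift c : R -> R)^`())%classic = cst 1.
    by apply/funext => x; rewrite derive1E; exact: (@derive_val _ _ _ _ _ _ _ (is_derive_shift x 1 c)).
  rewrite /Rintegral [in RHS](@increasing_ge0_integration_by_substitutionT _ (shift c))//.
  - congr fine; apply: eq_integral => x _; congr EFin.
    by rewrite dS fctE /= mulr1.
  - by move=> x y xy; rewrite /= ltrD2r.
  - by rewrite dS => x; exact: cvg_cst.
  - by rewrite dS; exact: is_cvg_cst.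
  - by rewrite dS; exact: is_cvg_cst.
  - exact: cvg_addrr_Ny.
  - exact: cvg_addrr.
move=> df; have [C fC] := cauchy_dominated_shift df.
have iT := cauchy_dominated_integrable (@measurableT _ R).
have dw := cauchy_dominatedZ C cauchy_dominated_cauchyw.
have := H0 _ (cauchy_dominatedD df dw).1 fC.
rewrite RintegralD//; [|exact/iT/cauchy_dominated_translation
  |by apply: iT; exact: (cauchy_dominated_translation c dw)].
rewrite RintegralD//; [|exact: iT|exact: iT].
rewrite !RintegralZl//; [|exact/iT/cauchy_dominated_cauchyw
  |by apply: iT; exact: (cauchy_dominated_translation c cauchy_dominated_cauchyw)].
by rewrite (H0 _ continuous_cauchyw cauchyw_ge0) => /addIr.
Qed.

Lemma cvgy_cauchyw : cauchyw t @[t --> +oo] --> 0.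
Proof.
apply/gtr0_cvgV0; first by apply: nearW => t; rewrite -invr_gt0 cauchyw_gt0.
apply: (cvg_comp (fun t : R => t ^+ 2) (fun t => 1 + t)); last exact: cvg_addrl.
exact: cvgr_expr2.
Qed.

Lemma cauchy_dominated_cvgy f : cauchy_dominated f -> f t @[t --> +oo] --> (0 : R).
Proof.
move=> [_ [C fC]].
have wC : C * cauchyw t @[t --> +oo] --> (0 : R).
  by rewrite -[X in _ --> X](mulr0 C); apply: cvgM; [exact: cvg_cst|exact: cvgy_cauchyw].
have wNC : - (C * cauchyw t) @[t --> +oo] --> (0 : R).
  by rewrite -[X in _ --> X]oppr0; exact: cvgN.
by apply: (squeeze_cvgr _ wNC wC); apply: nearW => t; rewrite -ler_norml.
Qed.

Lemma cauchy_dominated_cvgNy f : cauchy_dominated f -> f t @[t --> -oo] --> (0 : R).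
Proof.
by move=> /cauchy_dominatedN/cauchy_dominated_cvgy fN; exact/cvgNy_compNP.
Qed.

End CauchyWeight.

(** * Measurability and Fubini on products *)

Section ProductMeasurability.
Context {R : realType}.

Let step (n : nat) (x : R) : R := (Num.floor (x * n.+1%:R))%:~R / n.+1%:R.

Let cvg_step x : step n x @[n --> \oo] --> x.
Proof.
have H0 : (fun n => x - n.+1%:R^-1) @ \oo --> x.
  rewrite -[X in _ --> X]subr0; apply: cvgB; first exact: cvg_cst.
  exact: cvg_harmonic.
apply: (squeeze_cvgr _ H0 (cvg_cst x)); apply: nearW => n.
have n0 : 0 < n.+1%:R :> R by [].
rewrite /step ler_pdivrMr// ler_pdivlMr// mulrBl mulVf ?lt0r_neq0//.
have /andP[h1 h2] := floor_itv (x * n.+1%:R).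
by rewrite h1 andbT; rewrite intrD in h2; lra.
Qed.

Lemma cvg_comp_pair (T : Type) (F : set_system T) {FF : Filter F}
    (f : R * R -> R) (u v : T -> R) (a b : R) :
  {for (a, b), continuous f} -> u @ F --> a -> v @ F --> b ->
  f (u t, v t) @[t --> F] --> f (a, b).
Proof.
move=> cf ua vb.
exact: (cvg_comp (fun t => (u t, v t)) f (cvg_pair ua vb) cf).
Qed.

(** A continuous function on the plane is measurable for the product
    sigma-algebra: discretize the first variable. *)
Lemma measurable_continuous2 (f : R * R -> R) :
  continuous f -> measurable_fun [set: R * R] f.
Proof.
move=> cf; apply: (@measurable_fun_cvg _ _ _ _ (fun n z => f (step n z.1, z.2))).
- move=> n _ /= A mA; rewrite setTI.
  have -> : (fun z => f (step n z.1, z.2)) @^-1` A =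
    \bigcup_(k : int) ([set x | Num.floor (x * n.+1%:R) = k] `*`
                       ((fun y => f (k%:~R / n.+1%:R, y)) @^-1` A)).
    apply/seteqP; split=> [[x y] /= Axy|[x y] [k _ [/= <-]]//].
    by exists (Num.floor (x * n.+1%:R)).
  apply: countable_bigcupT_measurable; first exact: countableP.
  move=> k; apply: measurableX.
    (* the level sets of the discretization are half-open intervals *)
    have -> : [set x : R | Num.floor (x * n.+1%:R) = k] =
        [set` `[k%:~R / n.+1%:R, (k + 1)%:~R / n.+1%:R[] :> set R.
      apply/seteqP; split=> x /=; rewrite in_itv/= ler_pdivrMr// ltr_pdivlMr//.
        by move=> <-; exact: floor_itv.
      exact: floor_def.
    exact: measurable_itv.
  rewrite -[X in measurable X]setTI.
  apply: continuous_measurable_fun => // y.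
  by apply: cvg_comp_pair; [exact: cf|exact: cvg_cst|exact: cvg_id].
- move=> [x y] _ /=.
  by apply: cvg_comp_pair; [exact: cf|exact: cvg_step|exact: cvg_cst].
Qed.

End ProductMeasurability.

Section FubiniDominated.
Context {R : realType} d1 d2 (T1 : measurableType d1) (T2 : measurableType d2).
Variables (m1 : {sigma_finite_measure set T1 -> \bar R})
  (m2 : {sigma_finite_measure set T2 -> \bar R}).
Variables (F : T1 * T2 -> R) (g1 : T1 -> R) (g2 : T2 -> R).
Hypotheses (mF : measurable_fun setT F)
  (ig1 : m1.-integrable setT (EFin \o g1))
  (ig2 : m2.-integrable setT (EFin \o g2))
  (Fg : forall x y, `|F (x, y)| <= g1 x * g2 y).

Lemma integrable_section x : m2.-integrable setT (EFin \o (fun y => F (x, y))).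
Proof.
apply: (le_integrable _ _ _ (integrableZl measurableT (g1 x) ig2)) => //.
  by apply/measurable_EFinP; exact: (measurable_fun_pair2 x mF).
by move=> y _ /=; rewrite lee_fin (le_trans (Fg x y))// ler_norm.
Qed.

Lemma integrable_prod_dominated : (m1 \x m2)%E.-integrable setT (EFin \o F).
Proof.
have mEF : measurable_fun setT (EFin \o F) by exact/measurable_EFinP.
apply/integrable12ltyP => //=.
have i1 := integrable_abse ig1; have i2 := integrable_abse ig2.
have m2g : measurable_fun setT (fun y => `|(EFin \o g2) y|%E).
  by case/integrableP : i2.
have m1g : measurable_fun setT (fun y => `|(EFin \o g1) y|%E).
  by case/integrableP : i1.
apply: (@le_lt_trans _ _ (\int[m1]_x (`|(EFin \o g1) x| * \int[m2]_y `|(EFin \o g2) y|))%E).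
  apply: ge0_le_integral => //=.
  - by move=> x _; exact: integral_ge0.
  - apply: (measurable_fun_fubini_tonelli_F (abse \o (EFin \o F))) => //=.
    exact: measurableT_comp.
  - by apply: emeasurable_funM => //; exact: measurable_cst.
  - move=> x _; rewrite -ge0_integralZl//.
    apply: ge0_le_integral => //=.
    + by case/integrableP: (integrable_abse (integrable_section x)).
    + by apply: emeasurable_funM => //; exact: measurable_cst.
    + by move=> y _; rewrite lee_fin -normrM (le_trans (Fg x y))// ler_norm.
rewrite ge0_integralZr//; last exact: integral_ge0.
rewrite lte_mul_pinfty//.
- exact: integral_ge0.
- by case/integrableP : ig1 => _ /=; rewrite ge0_fin_numE//; exact: integral_ge0.
- by case/integrableP : ig2.
Qed.

Lemma Rintegral_prod :
  \int[(m1 \x m2)%E]_z F z = \int[m1]_x \int[m2]_y F (x, y).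
Proof.
rewrite /Rintegral -integral12_prod_meas1; last exact: integrable_prod_dominated.
congr fine; apply: eq_integral => x _ /=.
rewrite fineK//; exact: (integrable_fin_num _ (integrable_section x)).
Qed.

End FubiniDominated.

Lemma Rintegral_Fubini {R : realType} d1 d2 (T1 : measurableType d1)
    (T2 : measurableType d2) (m1 : {sigma_finite_measure set T1 -> \bar R})
    (m2 : {sigma_finite_measure set T2 -> \bar R})
    (F : T1 * T2 -> R) (g1 : T1 -> R) (g2 : T2 -> R) :
  measurable_fun setT F ->
  m1.-integrable setT (EFin \o g1) -> m2.-integrable setT (EFin \o g2) ->
  (forall x y, `|F (x, y)| <= g1 x * g2 y) ->
  \int[m1]_x \int[m2]_y F (x, y) = \int[m2]_y \int[m1]_x F (x, y).
Proof.
move=> mF ig1 ig2 Fg; rewrite -(Rintegral_prod mF ig1 ig2 Fg).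
rewrite /Rintegral -integral21_prod_meas1; last exact: integrable_prod_dominated mF ig1 ig2 Fg.
congr fine; apply: eq_integral => y _ /=; rewrite /fubini_G/= fineK//.
apply: (integrable_fin_num measurableT).
apply: (le_integrable _ _ _ (integrableZr measurableT (g2 y) ig1)) => //.
  by apply/measurable_EFinP; exact: measurable_fun_pair1.
by move=> x _ /=; rewrite lee_fin (le_trans (Fg x y))// ler_norm.
Qed.

Section LebesguePlane.
Context {R : realType}.
Local Notation mu := (@lebesgue_measure R).

(** Lebesgue measure on the plane, as a product measure. *)
Definition lebesgue2 := (mu \x mu)%E.

HB.instance Definition _ := Measure.copy lebesgue2 (mu \x mu)%E.

Let lebesgue2_sigma_finite : sigma_finite setT lebesgue2.
Proof.
have /sigma_finiteP[F [TF ndF Foo]] := sigma_finiteT mu.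
exists (fun n => F n `*` F n).
  rewrite -setXTT {1 2}TF predeqE => -[x y]; split.
    move=> [/= [n _ Fnx] [k _ Fky]]; exists (maxn n k) => //; split.
    - by move: x Fnx; exact/subsetPset/ndF/leq_maxl.
    - by move: y Fky; exact/subsetPset/ndF/leq_maxr.
  by move=> [n _ []/= ? ?]; split; exists n.
move=> k; have [? ?] := Foo k; split; first exact: measurableX.
by rewrite [lebesgue2 _]product_measure1E// lte_mul_pinfty// ge0_fin_numE.
Qed.

HB.instance Definition _ := Measure_isSigmaFinite.Build _ _ _ lebesgue2
  lebesgue2_sigma_finite.

End LebesguePlane.

(** * Injectivity of the Radon transform *)

Section RadonKernel.
Context {R : realType}.
Local Notation mu := (@lebesgue_measure R).
Implicit Types m b x y t : R.

(** The kernel [k(m, b) = (d^2 - b^2) / (d^2 + b^2)^2] with [d = 1 + |m|], the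
    real part of [1 / (d - i b)^2]. *)
Definition radon_kernel m b : R :=
  ((1 + `|m|) ^+ 2 - b ^+ 2) / ((1 + `|m|) ^+ 2 + b ^+ 2) ^+ 2.

Let den_gt0 m b : 0 < (1 + `|m|) ^+ 2 + b ^+ 2.
Proof. by rewrite ltr_wpDr ?sqr_ge0// exprn_gt0// ltr_wpDr. Qed.

Let radon_kernel_le m b :
  `|radon_kernel m b| <= ((1 + `|m|) ^+ 2 + b ^+ 2)^-1.
Proof.
rewrite /radon_kernel normrM normfV [`|_ ^+ 2|]ger0_norm ?sqr_ge0//.
pose D := (1 + `|m|) ^+ 2 + b ^+ 2; have D0 : 0 < D by exact: den_gt0.
rewrite -/D.
rewrite [D ^+ 2]expr2 invfM mulrA ler_piMl ?invr_ge0 ?(ltW D0)//.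
rewrite ler_pdivrMr// mul1r ler_norml.
by rewrite /D; have := sqr_ge0 (1 + `|m|); have := sqr_ge0 b; lra.
Qed.

Lemma radon_kernel_le_slope m b : `|radon_kernel m b| <= cauchyw m.
Proof.
apply: (le_trans (radon_kernel_le m b)); rewrite lef_pV2 ?posrE//.
rewrite /oneDsqr -(real_normK (num_real m)).
have := sqr_ge0 b; have := normr_ge0 m; nra.
Qed.

Lemma radon_kernel_le_offset m b : `|radon_kernel m b| <= cauchyw b.
Proof.
apply: (le_trans (radon_kernel_le m b)); rewrite lef_pV2 ?posrE// lerD2r.
have := normr_ge0 m; nra.
Qed.

Lemma continuous_radon_kernel : continuous (fun z : R * R => radon_kernel z.1 z.2).
Proof.
have cd (z : R * R) : (1 + `|z.1|) ^+ 2 @[z --> z] --> (1 + `|z.1|) ^+ 2.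
  apply: (@cvg_comp _ _ _ (fun z : R * R => 1 + `|z.1|) (fun x : R => x ^+ 2));
    last exact: exprn_continuous.
  by apply: cvgD; [exact: cvg_cst|apply: cvg_norm; exact: cvg_fst].
have cb (z : R * R) : z.2 ^+ 2 @[z --> z] --> z.2 ^+ 2.
  apply: (@cvg_comp _ _ _ (fun z : R * R => z.2) (fun x : R => x ^+ 2)); last exact: exprn_continuous.
  exact: cvg_snd.
move=> z; apply: cvgM.
  by apply: cvgB; [exact: cd|exact: cb].
apply: cvgV; first by rewrite expf_neq0// gt_eqF.
apply: (@cvg_comp _ _ _ (fun z : R * R => (1 + `|z.1|) ^+ 2 + z.2 ^+ 2) (fun x : R => x ^+ 2));
  last exact: exprn_continuous.
by apply: cvgD; [exact: cd|exact: cb].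
Qed.

(* On nonnegative slopes, [- P] is a primitive of [m |-> k(m, y - m x)]; it
   tends to zero at infinity. *)
Let P x y m : R := ((1 + x * y) + m * (1 - x ^+ 2)) /
  ((1 + x ^+ 2) * ((1 + m) ^+ 2 + (y - x * m) ^+ 2)).

Let is_derive_P x y m : 0 <= m ->
  is_derive m 1 (fun m => - P x y m) (radon_kernel m (y - m * x)).
Proof.
move=> m0.
have dlin a b : is_derive m 1 (fun m : R => a + m * b) b.
  apply: (is_derive_eq (is_deriveD (is_derive_cst a m 1)
    (is_deriveM (is_derive_id m 1) (is_derive_cst b m 1)))).
  by rewrite add0r scaler0 add0r /= /GRing.scale/= mulr1.
have D0 : 0 < (1 + m) ^+ 2 + (y - x * m) ^+ 2.
  by have := den_gt0 m (y - x * m); rewrite ger0_norm.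
have x0 : 0 < 1 + x ^+ 2 :> R by rewrite ltr_wpDr ?sqr_ge0.
have dD : is_derive m 1 (fun m : R => (1 + x ^+ 2) * ((1 + m) ^+ 2 + (y - x * m) ^+ 2))
   ((1 + x ^+ 2) * (2 * (1 + m) - 2 * x * (y - x * m))).
  have := is_deriveZ (1 + x ^+ 2) (is_deriveD (is_deriveX 2 (dlin 1 1)) (is_deriveX 2 (dlin y (- x)))).
  rewrite [X in is_derive _ _ X _](_ : _ =
    (fun m : R => (1 + x ^+ 2) * ((1 + m) ^+ 2 + (y - x * m) ^+ 2))); last first.
    by apply/funext => t /=; rewrite /GRing.scale/= !fctE mulr1 mulrN (mulrC t).
  move=> h; apply: (is_derive_eq h); rewrite /GRing.scale/=; ring.
have nz : (1 + x ^+ 2) * ((1 + m) ^+ 2 + (y - x * m) ^+ 2) != 0 by rewrite mulf_neq0// gt_eqF.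
have := is_deriveN (is_deriveM (dlin (1 + x * y) (1 - x ^+ 2))
  (@is_deriveV _ (fun m : R => (1 + x ^+ 2) * ((1 + m) ^+ 2 + (y - x * m) ^+ 2)) _ _ _ nz dD)).
move=> h; apply: (is_derive_eq h).
rewrite /radon_kernel ger0_norm// /GRing.scale/=.
have := lt0r_neq0 D0; have := lt0r_neq0 x0; rewrite [m * x]mulrC.
move=> ? ?; field.
by apply/andP.
Qed.

Let cvg_P x y : P x y m @[m --> +oo] --> (0 : R).
Proof.
pose c := (1 + `|x * y| + x ^+ 2).
have cv : (c / (1 + m)) @[m --> +oo] --> (0 : R).
  rewrite -[X in _ --> X](mulr0 c); apply: cvgM; first exact: cvg_cst.
  apply/gtr0_cvgV0; last exact: cvg_addrl.
  by near=> m; rewrite ltr_wpDr//; near: m; exact: nbhs_pinfty_ge.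
have cvN : (- (c / (1 + m))) @[m --> +oo] --> (0 : R).
  by rewrite -oppr0; exact: cvgN.
apply: (squeeze_cvgr _ cvN cv); near=> m; rewrite -ler_norml.
have m0 : 0 <= m by near: m; exact: nbhs_pinfty_ge.
rewrite /P normrM normfV.
have x0 : 1 <= 1 + x ^+ 2 :> R by rewrite lerDl sqr_ge0.
have m1 : 0 < 1 + m by rewrite ltr_wpDr.
rewrite ler_pdivrMr; last first.
  rewrite normr_gt0 mulf_neq0// gt_eqF//; first by lra.
  by have := den_gt0 m (y - x * m); rewrite (ger0_norm m0).
have D0 : 0 < (1 + m) ^+ 2 + (y - x * m) ^+ 2.
  by have := den_gt0 m (y - x * m); rewrite (ger0_norm m0).
rewrite [X in _ <= _ * X]ger0_norm; last by rewrite mulr_ge0//; [lra|exact: ltW].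
have N1 : `|1 + x * y + m * (1 - x ^+ 2)| <= c * (1 + m).
  rewrite /c; have h : `|1 - x ^+ 2| <= 1 + x ^+ 2.
    by rewrite ler_norml; have := sqr_ge0 x; lra.
  have := ler_wpM2l m0 h; rewrite -{1}(ger0_norm m0) -normrM => h'.
  apply: (le_trans (ler_normD _ _)); apply: (le_trans (lerD (ler_normD _ _) h')).
  have := normr_ge0 (x * y); rewrite normr1; have := sqr_ge0 x; nra.
apply: (le_trans N1); rewrite mulrAC ler_pdivlMr// -mulrA ler_wpM2l//.
  by rewrite /c; have := normr_ge0 (x * y); have := sqr_ge0 x; lra.
rewrite -expr2; have := sqr_ge0 (y - x * m); have := sqr_ge0 x; have := D0; nra.
Unshelve. all: end_near. Qed.

Lemma radon_kernel_dominated x y :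
  cauchy_dominated (fun m => radon_kernel m (y - m * x)).
Proof.
split; last by exists 1 => m; rewrite mul1r radon_kernel_le_slope.
move=> m; apply: (@cvg_comp_pair R _ _ _ (fun z : R * R => radon_kernel z.1 z.2)
  (fun m => m) (fun m => y - m * x)).
- exact: continuous_radon_kernel.
- exact: cvg_id.
- by apply: cvgB; [exact: cvg_cst|apply: cvgM; [exact: cvg_id|exact: cvg_cst]].
Qed.

(** Averaging the kernel over all lines through a point gives a product of
    Cauchy weights. *)
Lemma Rintegral_radon_kernel x y :
  \int[mu]_m radon_kernel m (y - m * x) = 2 * (cauchyw x * cauchyw y).
Proof.
rewrite Rintegral_setT_half; last exact: radon_kernel_dominated.
have i := cauchy_dominated_integrable (measurable_itv `[0, +oo[).
have d1 := radon_kernel_dominated x y.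
have eN : (fun m => radon_kernel (- m) (y - - m * x)) = (fun m => radon_kernel m (y - m * - x)).
  by apply/funext => m; rewrite /radon_kernel normrN mulNr mulrN.
have d2 : cauchy_dominated (fun m => radon_kernel (- m) (y - - m * x)).
  by rewrite eN; exact: radon_kernel_dominated.
rewrite RintegralD//; [|exact: i|exact: i].
have K z : \int[mu]_(m in `[0, +oo[) radon_kernel m (y - m * z) = (1 + z * y) * (cauchyw z * cauchyw y).
  transitivity (0 - - P z y 0); last first.
    rewrite sub0r opprK /P mul0r addr0 addr0 expr1n mulr0 subr0.
    by rewrite /cauchyw /oneDsqr invfM.
  have lim0 : - P z y m @[m --> +oo] --> (0 : R).
    by rewrite -oppr0; apply: cvgN; exact: cvg_P.
  have dP m : 0 <= m -> is_derive m 1 (fun m => - P z y m) (radon_kernel m (y - m * z)).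
    exact: is_derive_P.
  exact: (@Rintegral_cauchy_dominated R _ (fun m => - P z y m) 0 (radon_kernel_dominated z y) dP lim0).
rewrite eN !K cauchywN; ring.
Qed.

End RadonKernel.

Section RadonInjectivity.
Context {R : realType}.
Local Notation mu := (@lebesgue_measure R).
Local Notation mu2 := (@lebesgue2 R).
Implicit Types phi : R * R -> R.

Let iw := @integrable_cauchyw R.

Let measurable_cauchyw2 :
  measurable_fun setT (fun z : R * R => cauchyw z.1 * cauchyw z.2).
Proof.
apply: measurable_funM.
  apply: (measurableT_comp _ measurable_fst).
  exact: continuous_measurable_fun continuous_cauchyw.
apply: (measurableT_comp _ measurable_snd).
exact: continuous_measurable_fun continuous_cauchyw.
Qed.

Let integrable_cauchyw2 (C : R) :
  mu2.-integrable setT (EFin \o (fun z : R * R => C * (cauchyw z.1 * cauchyw z.2))).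
Proof.
apply: (@integrable_prod_dominated _ _ _ _ _ mu mu _ (fun x => `|C| * cauchyw x) cauchyw) => //.
- by apply: measurable_funM; [exact: measurable_cst|exact: measurable_cauchyw2].
- apply: cauchy_dominated_integrable => //.
  exact: cauchy_dominatedZ cauchy_dominated_cauchyw.
- by move=> x y /=; rewrite !normrM !(ger0_norm (cauchyw_ge0 _)) mulrA.
Qed.

Let integrable_mul_cauchyw2 (g : R * R -> R) (M : R) : measurable_fun setT g ->
  (forall z, `|g z| <= M) ->
  mu2.-integrable setT (EFin \o (fun z : R * R => g z * (cauchyw z.1 * cauchyw z.2))).
Proof.
move=> mg gM; apply: (le_integrable _ _ _ (integrable_cauchyw2 M)) => //.
  by apply/measurable_EFinP; apply: measurable_funM => //; exact: measurable_cauchyw2.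
move=> z _ /=; rewrite lee_fin !normrM ler_wpM2r ?mulr_ge0//.
by rewrite (le_trans (gM z))// ler_norm.
Qed.

Let continuous_line phi (u v : R -> R) : continuous phi -> continuous u ->
  continuous v -> continuous (fun t => phi (u t, v t)).
Proof.
by move=> cphi cu cv t; apply: cvg_comp_pair; [exact: cphi|exact: cu|exact: cv].
Qed.

Let measurable_pair_comp d (T : measurableType d) (h : R * R -> R) (u v : T -> R) :
  measurable_fun setT h -> measurable_fun setT u -> measurable_fun setT v ->
  measurable_fun setT (fun t => h (u t, v t)).
Proof.
by move=> mh mu mv; exact: (measurableT_comp mh (measurable_fun_pair mu mv)).
Qed.

(** If the lines of all slopes but finitely many integrate [phi] to zero, then
    [phi] is orthogonal to the product of the Cauchy weights: exchange the
    integrals of [phi z * k(m, b)] over the slope [m] and over the point [z], [b]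
    being the offset of the line of slope [m] through [z]. The three exceptional
    slopes are all that the application needs. *)
Lemma radon_average phi (C : R) : continuous phi ->
  (forall x y, `|phi (x, y)| <= C * (cauchyw x * cauchyw y)) ->
  (forall m b : R, m \notin [:: 0; 1; -1] -> \int[mu]_t phi (t, b + m * t) = 0) ->
  \int[mu2]_z (phi z * (cauchyw z.1 * cauchyw z.2)) = 0.
Proof.
move=> cphi phiC phi0.
have C0 : 0 <= C.
  by have := le_trans (normr_ge0 _) (phiC 0 0); rewrite pmulr_lge0// mulr_gt0// cauchyw_gt0.
pose F (p : R * (R * R)) := phi p.2 * radon_kernel p.1 (p.2.2 - p.1 * p.2.1).
have mk : measurable_fun setT (fun z : R * R => radon_kernel z.1 z.2).
  by apply: measurable_continuous2; exact: continuous_radon_kernel.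
have mphi : measurable_fun setT phi by exact: measurable_continuous2.
have mF : measurable_fun setT F.
  apply: measurable_funM; first exact: measurableT_comp.
  apply: (measurable_pair_comp mk); first exact: measurable_fst.
  apply: measurable_funB.
    exact: (measurableT_comp measurable_snd measurable_snd).
  apply: measurable_funM => //.
  exact: (measurableT_comp measurable_fst measurable_snd).
have Fb m z : `|F (m, z)| <= cauchyw m * (C * (cauchyw z.1 * cauchyw z.2)).
  rewrite /F normrM mulrC ler_pM//; first exact: radon_kernel_le_slope.
  by case: z => x y; exact: phiC.
have : \int[mu]_m \int[mu2]_z F (m, z) = \int[mu2]_z \int[mu]_m F (m, z).
  apply: (@Rintegral_Fubini R _ _ _ _ mu mu2 F cauchyw (fun z => C * (cauchyw z.1 * cauchyw z.2))).
  - exact: mF.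
  - exact: iw.
  - exact: integrable_cauchyw2.
  - exact: Fb.
have -> : \int[mu]_m \int[mu2]_z F (m, z) = 0.
  pose N : set R := [set` [:: 0; 1; -1] : seq R].
  have F0 m : ~ N m -> \int[mu2]_z F (m, z) = 0.
    move=> /= /negP Nm.
    have mFm : measurable_fun setT (fun z => F (m, z)).
      exact: (measurable_fun_pair2 m mF).
    have Fbm x y : `|F (m, (x, y))| <= (C * cauchyw x) * cauchyw y.
      apply: (le_trans (Fb _ _)); rewrite -mulrA ler_piMl ?cauchyw_le1//.
      by rewrite !mulr_ge0// cauchyw_ge0.
    have iC : mu.-integrable setT (EFin \o (fun x => C * cauchyw x)).
      apply: cauchy_dominated_integrable => //.
      exact: cauchy_dominatedZ cauchy_dominated_cauchyw.
    have -> : \int[mu2]_z F (m, z) = \int[mu]_x \int[mu]_y F (m, (x, y)).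
      exact: (@Rintegral_prod R _ _ _ _ mu mu (fun z => F (m, z)) (fun x => C * cauchyw x) cauchyw).
    transitivity (\int[mu]_x \int[mu]_b (phi (x, b + m * x) * radon_kernel m b)).
      apply: eq_Rintegral => x _; rewrite -(Rintegral_translation (m * x)).
        by apply: eq_Rintegral => b _; rewrite /F/= addrK.
      have cs : continuous (fun y : R => y - m * x).
        by move=> ?; apply: cvgB; [exact: cvg_id|exact: cvg_cst].
      have c1 := continuous_line (@continuous_radon_kernel R) (@cst_continuous R R m) cs.
      have c2 := continuous_line cphi (@cst_continuous R R x) (fun=> cvg_id).
      split; first by move=> y; exact: (cvgM (c2 y) (c1 y)).
      by exists (C * cauchyw x) => y; exact: Fbm.
    pose G (p : R * R) := phi (p.1, p.2 + m * p.1) * radon_kernel m p.2.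
    have mG : measurable_fun setT G.
      apply: measurable_funM.
        apply: (measurable_pair_comp mphi); first exact: measurable_fst.
        apply: measurable_funD; first exact: measurable_snd.
        by apply: measurable_funM; [exact: measurable_cst|exact: measurable_fst].
      by apply: (measurable_pair_comp mk); [exact: measurable_cst|exact: measurable_snd].
    have Gb x b : `|G (x, b)| <= (C * cauchyw x) * cauchyw b.
      rewrite /G normrM ler_pM//; last exact: radon_kernel_le_offset.
      apply: (le_trans (phiC _ _)); rewrite ler_wpM2l// ler_piMr ?cauchyw_ge0//.
      exact: cauchyw_le1.
    have -> : \int[mu]_x \int[mu]_b G (x, b) = \int[mu]_b \int[mu]_x G (x, b).
      exact: (@Rintegral_Fubini R _ _ _ _ mu mu G (fun x => C * cauchyw x) cauchyw).
    under eq_Rintegral.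
      move=> b _; rewrite /G/= RintegralZr//; last first.
        have cl : continuous (fun t : R => b + m * t).
          by move=> t; apply: cvgD; [exact: cvg_cst|apply: cvgM; [exact: cvg_cst|exact: cvg_id]].
        apply: cauchy_dominated_integrable => //.
        split; first exact: (continuous_line cphi (fun=> cvg_id) cl).
        exists C => t; apply: (le_trans (phiC _ _)).
        by rewrite ler_wpM2l// ler_piMr ?cauchyw_ge0// cauchyw_le1.
      rewrite phi0// mul0r; over.
    by rewrite Rintegral_cst// mul0r.
  have Nc : countable N by apply: finite_set_countable; exact: finite_seq.
  have N0 : mu N = 0 by exact: countable_lebesgue_measure0.
  have mN : measurable N by apply: countable_measurable => // t; exact: measurable_set1.
  have iF : (mu \x mu2)%E.-integrable setT (EFin \o F).
    exact: (@integrable_prod_dominated R _ _ _ _ mu mu2 F cauchyw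
      (fun z => C * (cauchyw z.1 * cauchyw z.2)) mF iw (integrable_cauchyw2 C) Fb).
  have iFF := integrable_fubini_F iF.
  have iR : mu.-integrable setT (EFin \o (fun m => \int[mu2]_z F (m, z))).
    apply: (eq_integrable measurableT _ _ _ iFF) => m _ /=.
    rewrite /fubini_F /Rintegral fineK//=.
    apply: (integrable_fin_num measurableT).
    exact: (@integrable_section R _ _ _ _ mu2 F cauchyw
      (fun z => C * (cauchyw z.1 * cauchyw z.2)) mF (integrable_cauchyw2 C) Fb m).
  have -> : \int[mu]_m \int[mu2]_z F (m, z) = fine 0%E; last by [].
  rewrite [LHS]/Rintegral; congr fine.
  transitivity (\int[mu]_(m in setT `\` N) (\int[mu2]_z F (m, z))%:E)%E.
    exact: negligible_integral.
  by apply: integral0_eq => m [_ /F0 ->].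
under eq_Rintegral => z _.
  rewrite /F/= RintegralZl//=; last first.
    apply: cauchy_dominated_integrable => //; exact: radon_kernel_dominated.
  rewrite Rintegral_radon_kernel mulrCA.
  over.
rewrite RintegralZl//; last first.
  apply: (@integrable_mul_cauchyw2 _ C) => // -[x y].
  apply: (le_trans (phiC x y)); rewrite ler_piMr//.
  by rewrite mulr_ile1 ?cauchyw_ge0 ?cauchyw_le1.
by move=> /esym/eqP; rewrite mulf_eq0 pnatr_eq0/= => /eqP.
Qed.

Let integral_cauchyw2_gt0 :
  0 < \int[mu2]_z (cauchyw z.1 * cauchyw z.2 : R).
Proof.
have -> : \int[mu2]_z (cauchyw z.1 * cauchyw z.2) =
    \int[mu]_x \int[mu]_y (cauchyw x * cauchyw y).
  apply: (@Rintegral_prod R _ _ _ _ mu mu (fun z => cauchyw z.1 * cauchyw z.2) cauchyw cauchyw).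
  - exact: measurable_cauchyw2.
  - exact: iw.
  - exact: iw.
  - by move=> x y /=; rewrite normrM !ger0_norm ?cauchyw_ge0.
under eq_Rintegral => x _ do rewrite RintegralZl// Rintegral_cauchyw.
by rewrite RintegralZr// Rintegral_cauchyw mulr_gt0// pi_gt0.
Qed.

(** Vanishing at the point [(x0, y0)] follows from [radon_average] applied to
    [psi] rescaled around that point, as the scale tends to zero. *)
Lemma radon_injective (psi : R * R -> R) (M : R) : continuous psi ->
  (forall z, `|psi z| <= M) ->
  (forall e x0 y0 : R, 0 < e -> exists C, forall x y,
     `|psi (x0 + e * x, y0 + e * y)| <= C * (cauchyw x * cauchyw y)) ->
  (forall e m x0 y0 : R, 0 < e -> m \notin [:: 0; 1; -1] ->
     \int[mu]_t psi (x0 + e * t, y0 + e * m * t) = 0) ->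
  forall z, psi z = 0.
Proof.
move=> cpsi psiM psiC psi0 [x0 y0].
pose e n : R := n.+1%:R^-1.
have e0 n : 0 < e n by rewrite invr_gt0.
pose ph n (z : R * R) := psi (x0 + e n * z.1, y0 + e n * z.2).
have clin (a b : R) : continuous (fun t : R => a + b * t).
  by move=> t; apply: cvgD; [exact: cvg_cst|apply: cvgM; [exact: cvg_cst|exact: cvg_id]].
have cph n : continuous (ph n).
  move=> z.
  have c1 : x0 + e n * z.1 @[z --> z] --> x0 + e n * z.1.
    by apply: cvgD; [exact: cvg_cst|apply: cvgM; [exact: cvg_cst|exact: cvg_fst]].
  have c2 : y0 + e n * z.2 @[z --> z] --> y0 + e n * z.2.
    by apply: cvgD; [exact: cvg_cst|apply: cvgM; [exact: cvg_cst|exact: cvg_snd]].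
  have h := cvg_comp_pair (cpsi (x0 + e n * z.1, y0 + e n * z.2)) c1 c2.
  exact: h.
have ph0 n : \int[mu2]_z (ph n z * (cauchyw z.1 * cauchyw z.2)) = 0.
  have [C phC] := psiC (e n) x0 y0 (e0 n).
  apply: (@radon_average (ph n) C) => // m b mN.
  rewrite -[RHS](psi0 (e n) m x0 (y0 + e n * b) (e0 n) mN).
  by apply: eq_Rintegral => t _; rewrite /ph/= mulrDr mulrA addrA.
have mw2 := measurable_cauchyw2.
have w20 (z : R * R) : 0 <= cauchyw z.1 * cauchyw z.2 by rewrite mulr_ge0 ?cauchyw_ge0.
have ce : e n @[n --> \oo] --> (0 : R) by exact: cvg_harmonic.
have mEF (g : R * R -> R) : measurable_fun setT g ->
    measurable_fun setT (fun z => (g z * (cauchyw z.1 * cauchyw z.2))%:E).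
  by move=> mg; apply/measurable_EFinP; apply: measurable_funM.
have A1 n := mEF _ (measurable_continuous2 (cph n)).
have A2 := mEF _ (@measurable_cst _ _ _ _ setT (psi (x0, y0))).
have A3 : {ae mu2, forall z, setT z ->
    (ph n z * (cauchyw z.1 * cauchyw z.2))%:E @[n --> \oo] -->
    (psi (x0, y0) * (cauchyw z.1 * cauchyw z.2))%:E}.
  apply: aeW => z _; apply: cvg_EFin; first by near=> n.
  apply: cvgM; last exact: cvg_cst.
  have c (a b : R) : a + e n * b @[n --> \oo] --> a.
    rewrite -[X in _ --> X]addr0 -(mul0r b).
    by apply: cvgD; [exact: cvg_cst|apply: cvgM; [exact: ce|exact: cvg_cst]].
  exact: (cvg_comp_pair (cpsi (x0, y0)) (c x0 z.1) (c y0 z.2)).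
have A4 : {ae mu2, forall z n, setT z ->
    (`|(ph n z * (cauchyw z.1 * cauchyw z.2))%:E| <=
    (M * (cauchyw z.1 * cauchyw z.2))%:E)%E}.
  apply: aeW => z n _ /=; rewrite lee_fin normrM (ger0_norm (w20 z)).
  by rewrite ler_wpM2r//; exact: psiM.
have [ipsi _ cvgpsi] := @dominated_convergence _ _ R mu2 setT measurableT
  (fun n z => (ph n z * (cauchyw z.1 * cauchyw z.2))%:E)
  (fun z => (psi (x0, y0) * (cauchyw z.1 * cauchyw z.2))%:E)
  (fun z => (M * (cauchyw z.1 * cauchyw z.2))%:E)
  A1 A2 A3 (integrable_cauchyw2 M) A4.
have : \int[mu2]_z (psi (x0, y0) * (cauchyw z.1 * cauchyw z.2)) = 0.
  rewrite /Rintegral.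
  suff -> : (\int[mu2]_z (psi (x0, y0) * (cauchyw z.1 * cauchyw z.2))%:E = 0)%E by [].
  apply: (cvg_unique _ cvgpsi); first exact: ereal_hausdorff.
  have E n : (\int[mu2]_z (ph n z * (cauchyw z.1 * cauchyw z.2))%:E = 0)%E.
    rewrite -[LHS]fineK; first by congr EFin; exact: ph0.
    apply: (integrable_fin_num measurableT).
    apply: (@integrable_mul_cauchyw2 _ M) => [|z]; last exact: psiM.
    exact: measurable_continuous2.
  rewrite (_ : [sequence _]_n = cst 0%E); last by apply/funext => n; exact: E.
  exact: cvg_cst.
rewrite RintegralZl//; last first.
  apply: (eq_integrable measurableT _ _ _ (integrable_cauchyw2 1)) => z _ /=.
  by rewrite mul1r.
by move=> /eqP; rewrite mulf_eq0 [X in _ || X]gt_eqF ?integral_cauchyw2_gt0// orbF => /eqP.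
Unshelve. all: end_near. Qed.

End RadonInjectivity.

(** * Calculus of smooth functions on the plane *)

Section Smooth.
Context {R : realType} {n : nat}.
Implicit Types (g f : 'rV[R]_n -> R) (x v : 'rV[R]_n) (i j : 'I_n).

Lemma smooth_continuous g : smooth g -> continuous g.
Proof. by move=> /(_ [::])[]. Qed.

Lemma smooth_derivable g i x : smooth g -> derivable g x (delta_mx 0 i).
Proof. by move=> /(_ [::])[_]. Qed.

Lemma partials_rcons s i g : partials s (partial i g) = partials (rcons s i) g.
Proof. by rewrite -cats1 /partials foldr_cat. Qed.

Lemma smooth_partial g i : smooth g -> smooth (partial i g).
Proof. by move=> sg s; rewrite partials_rcons. Qed.

Lemma smooth_partials g s : smooth g -> smooth (partials s g).
Proof. by move=> sg; elim: s => [//|i s IH]; exact: smooth_partial IH. Qed.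

Lemma partialD g f i : smooth g -> smooth f ->
  partial i (fun x => g x + f x) = fun x => partial i g x + partial i f x.
Proof.
move=> sg sf; apply/funext => x.
by rewrite /partial -deriveD//; exact: smooth_derivable.
Qed.

Lemma partialZ k g i : smooth g ->
  partial i (fun x => k * g x) = fun x => k * partial i g x.
Proof.
move=> sg; apply/funext => x.
by rewrite /partial -[RHS](@deriveZ _ _ _ g k)//; exact: smooth_derivable.
Qed.

Lemma partialsD g f s : smooth g -> smooth f ->
  partials s (fun x => g x + f x) = fun x => partials s g x + partials s f x.
Proof.
move=> sg sf; elim: s => //= i s ->.
exact: (partialD i (smooth_partials s sg) (smooth_partials s sf)).
Qed.

Lemma partialsZ k g s : smooth g ->
  partials s (fun x => k * g x) = fun x => k * partials s g x.
Proof.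
move=> sg; elim: s => //= i s ->.
exact: (partialZ k i (smooth_partials s sg)).
Qed.

Lemma smoothD g f : smooth g -> smooth f -> smooth (fun x => g x + f x).
Proof.
move=> sg sf s; rewrite partialsD//; split.
  by move=> x; exact: (cvgD ((sg s).1 x) ((sf s).1 x)).
by move=> i x; apply: derivableD; [exact: (sg s).2|exact: (sf s).2].
Qed.

Lemma smoothZ k g : smooth g -> smooth (fun x => k * g x).
Proof.
move=> sg s; rewrite partialsZ//; split.
  by move=> x; exact: (cvgM (cvg_cst k) ((sg s).1 x)).
by move=> i x; apply: (@derivableZ _ _ _ (partials s g) k); exact: (sg s).2.
Qed.

Lemma is_derive_along g x v (t : R) : derivable g (x + t *: v) v ->
  is_derive t 1 (fun t => g (x + t *: v)) ('D_v g (x + t *: v)).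
Proof.
move=> dg.
have E : (fun d : R => d^-1 *: (((fun t => g (x + t *: v)) \o shift t) (d *: 1)
                                - g (x + t *: v)))
    = (fun d => d^-1 *: ((g \o shift (x + t *: v)) (d *: v) - g (x + t *: v))).
  apply/funext => d /=; congr (_ *: (g _ - _)).
  by rewrite [d *: 1]mulr1 scalerDl addrCA.
by split; rewrite /derivable /derive E.
Qed.

Lemma continuous_affine x v : continuous (fun t : R => x + t *: v).
Proof.
move=> t; apply: cvgD; first exact: cvg_cst.
exact: (cvgZ cvg_id (cvg_cst v)).
Qed.

(** Mean value theorem along a coordinate line, for increments of either sign. *)
Lemma partial_MVT g x i (a : R) : (forall y, derivable g y (delta_mx 0 i)) ->
  exists2 c, `|c| <= `|a| &
    g (x + a *: delta_mx 0 i) - g x = a * partial i g (x + c *: delta_mx 0 i).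
Proof.
move=> dg; pose F t := g (x + t *: delta_mx 0 i).
pose dF t := partial i g (x + t *: delta_mx 0 i).
have dFF (t : R) : is_derive t 1 F (dF t) by exact: is_derive_along.
have cF (b c : R) : {within `[b, c], continuous F}.
  by apply: derivable_within_continuous => t _; have := dFF t; case.
have F0 : F 0 = g x by rewrite /F scale0r addr0.
have [a0|a0] := leP 0 a.
- have [c] := MVT_segment a0 (fun t _ => dFF t) (cF 0 a).
  rewrite in_itv/= => /andP[c0 ca]; rewrite F0 subr0 mulrC => E.
  by exists c => //; rewrite !ger0_norm.
- have [c] := MVT_segment (ltW a0) (fun t _ => dFF t) (cF a 0).
  rewrite in_itv/= => /andP[ac c0]; rewrite F0 sub0r => E.
  exists c; first by rewrite !ler0_norm ?lerN2// ltW.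
  by rewrite -/(F a) -opprB E mulrN opprK mulrC.
Qed.

Lemma cvg_mull0 (b : R) : h * b @[h --> 0] --> (0 : R).
Proof.
by rewrite -[X in _ --> X](mul0r b); apply: cvgM; [exact: cvg_id|exact: cvg_cst].
Qed.

(** An intermediate point given by the mean value theorem tends to the base
    point with the increment. *)
Lemma cvg_small (c : R -> R) b :
  (forall h, `|c h| <= `|h * b|) -> c h @[h --> 0] --> (0 : R).
Proof.
move=> cb; have nb : `|h * b| @[h --> 0] --> (0 : R).
  by have := cvg_norm (cvg_mull0 b); rewrite normr0; apply.
have nNb : - `|h * b| @[h --> 0] --> (0 : R).
  by rewrite -[X in _ --> X]oppr0; exact: cvgN.
by apply: (squeeze_cvgr _ nNb nb); apply: nearW => h; rewrite -ler_norml.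
Qed.

Lemma partial_shift g i c :
  partial i (fun x => g (x + c)) = fun x => partial i g (x + c).
Proof.
apply/funext => x; rewrite /partial /derive.
suff -> : (fun d : R => d^-1 *: (((fun x => g (x + c)) \o shift x) (d *: delta_mx 0 i)
    - g (x + c))) = (fun d => d^-1 *: ((g \o shift (x + c)) (d *: delta_mx 0 i)
    - g (x + c))) by [].
by apply/funext => d /=; rewrite addrA.
Qed.

Lemma smooth_shift g c : smooth g -> smooth (fun x => g (x + c)).
Proof.
move=> sg s; have -> : partials s (fun x => g (x + c)) = fun x => partials s g (x + c).
  by elim: s => //= i s ->; rewrite partial_shift.
have [cs ds] := sg s; split.
  move=> x; have cz : y + c @[y --> x] --> x + c by exact: (cvgD cvg_id (cvg_cst c)).
  exact: (cvg_comp _ _ cz (cs (x + c))).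
move=> i x; rewrite /derivable.
have -> : (fun d : R => d^-1 *: (((fun x => partials s g (x + c)) \o shift x) (d *: delta_mx 0 i)
    - partials s g (x + c))) = (fun d => d^-1 *: ((partials s g \o shift (x + c)) (d *: delta_mx 0 i)
    - partials s g (x + c))).
  by apply/funext => d /=; rewrite addrA.
exact: ds.
Qed.

(* The second difference of [g] is a mixed derivative at an intermediate point;
   it is symmetric in the two directions. *)
Let second_difference g x i j (h : R) : smooth g ->
  exists a b, [/\ `|a| <= `|h * 1|, `|b| <= `|h * 1| &
    g (x + h *: delta_mx 0 j + h *: delta_mx 0 i) - g (x + h *: delta_mx 0 j)
     - (g (x + h *: delta_mx 0 i) - g x) =
    h * (h * partial i (partial j g) (x + b *: delta_mx 0 j + a *: delta_mx 0 i))].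
Proof.
move=> sg; pose G y := g (y + h *: delta_mx 0 i) + -1 * g y.
have sG : smooth G by apply: smoothD; [exact: smooth_shift|exact: smoothZ].
have [b bh E] := partial_MVT x h (fun y => @smooth_derivable _ j y sG).
have [a ah E'] := partial_MVT (x + b *: delta_mx 0 j) h
  (fun y => @smooth_derivable _ i y (smooth_partial j sg)).
have GE y : G y = g (y + h *: delta_mx 0 i) - g y by rewrite /G mulN1r.
have dG : partial j G = fun y => partial j g (y + h *: delta_mx 0 i) - partial j g y.
  rewrite /G partialD; [|exact: smooth_shift|exact: smoothZ].
  by rewrite partialZ// partial_shift; apply/funext => y; rewrite mulN1r.
exists a, b; split; rewrite ?mulr1//.
by rewrite -(GE x) -(GE (x + h *: delta_mx 0 j)) E dG; congr (_ * _).
Qed.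

(** Symmetry of second derivatives. *)
Lemma partialC g i j : smooth g ->
  partial i (partial j g) = partial j (partial i g).
Proof.
move=> sg; apply/funext => x.
pose Q k l (h : R) (ab : R * R) := [/\ `|ab.1| <= `|h * 1|, `|ab.2| <= `|h * 1| &
    g (x + h *: delta_mx 0 l + h *: delta_mx 0 k) - g (x + h *: delta_mx 0 l)
     - (g (x + h *: delta_mx 0 k) - g x) =
    h * (h * partial k (partial l g)
      (x + ab.2 *: delta_mx 0 l + ab.1 *: delta_mx 0 k))].
have sd k l h : exists ab, Q k l h ab.
  by have [a [b P]] := second_difference x k l h sg; exists (a, b).
have [p pP] := choice (sd i j); have [q qP] := choice (sd j i).
have lim k l (r : R -> R * R) : (forall h, `|(r h).1| <= `|h * 1|) ->
    (forall h, `|(r h).2| <= `|h * 1|) ->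
    partial k (partial l g) (x + (r h).2 *: delta_mx 0 l + (r h).1 *: delta_mx 0 k)
      @[h --> 0^'] --> partial k (partial l g) x.
  move=> /cvg_small r1 /cvg_small r2; apply: cvg_within_filter.
  have /smooth_continuous cg := smooth_partial k (smooth_partial l sg).
  have cz : x + (r h).2 *: delta_mx 0 l + (r h).1 *: delta_mx 0 k @[h --> 0] --> x.
    rewrite -[X in _ --> X]addr0 -(scale0r (delta_mx 0 k)).
    apply: cvgD; last exact: (cvgZ r1 (cvg_cst _)).
    rewrite -[X in _ --> X]addr0 -(scale0r (delta_mx 0 l)).
    by apply: cvgD; [exact: cvg_cst|exact: (cvgZ r2 (cvg_cst _))].
  exact: (cvg_comp _ _ cz (cg x)).
have L1 := lim i j p (fun h => let: And3 P _ _ := pP h in P) (fun h => let: And3 _ P _ := pP h in P).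
have L2 := lim j i q (fun h => let: And3 P _ _ := qP h in P) (fun h => let: And3 _ P _ := qP h in P).
apply: (cvg_unique _ L1); first exact: Rhausdorff.
apply: cvg_trans L2; apply: near_eq_cvg; near=> h.
have h0 : h != 0 by near: h; exact: nbhs_dnbhs_neq.
have [_ _ Ep] := pP h; have [_ _ Eq] := qP h.
have sw (a b c d : R) : a - b - (c - d) = a - c - (b - d) by ring.
rewrite (addrAC x (h *: delta_mx 0 j)) sw Eq in Ep.
have inj (X Y : R) : h * (h * X) = h * (h * Y) -> X = Y.
  by move=> /(mulfI h0)/(mulfI h0).
move: Ep; exact: inj.
Unshelve. all: end_near. Qed.

End Smooth.

Section Plane.
Context {R : realType}.
Implicit Types (g : 'rV[R]_2 -> R) (x y v : 'rV[R]_2) (t : R).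

(** Directional derivative, written through the partial derivatives. *)
Definition along v g x : R := v 0 0 * partial 0 g x + v 0 1 * partial 1 g x.

Lemma rV2E v : v = v 0 0 *: 'e_0 + v 0 1 *: 'e_1.
Proof.
rewrite {1}(row_sum_delta v) 2!big_ord_recl big_ord0 addr0.
by rewrite (_ : lift ord0 ord0 = 1)//; exact/val_inj.
Qed.

(** A smooth function is differentiable in every direction. *)
Lemma cvg_along g y v : smooth g ->
  h^-1 *: (g (y + h *: v) - g y) @[h --> 0^'] --> along v g y.
Proof.
move=> sg; pose y1 h := y + (h * v 0 1) *: 'e_1.
have /choice[c1 c1P] (h : R) : exists c, `|c| <= `|h * v 0 1| /\
    g (y1 h) - g y = h * v 0 1 * partial 1 g (y + c *: 'e_1).
  by have [c ? ?] := partial_MVT y (h * v 0 1) (fun z => @smooth_derivable _ _ _ 1 z sg); exists c.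
have /choice[c0 c0P] (h : R) : exists c, `|c| <= `|h * v 0 0| /\
    g (y1 h + (h * v 0 0) *: 'e_0) - g (y1 h) =
    h * v 0 0 * partial 0 g (y1 h + c *: 'e_0).
  by have [c ? ?] := partial_MVT (y1 h) (h * v 0 0) (fun z => @smooth_derivable _ _ _ 0 z sg); exists c.
have lin (b : R) : h * b @[h --> 0] --> (0 : R) := cvg_mull0 b.
have c1_0 := cvg_small (fun h => (c1P h).1).
have c0_0 := cvg_small (fun h => (c0P h).1).
have cy1 : y1 h @[h --> 0] --> y.
  rewrite -[X in _ --> X]addr0 -(scale0r 'e_1).
  by apply: cvgD; [exact: cvg_cst|exact: (cvgZ (lin _) (cvg_cst _))].
have T1 : partial 1 g (y + c1 h *: 'e_1) @[h --> 0] --> partial 1 g y.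
  have /smooth_continuous cg := smooth_partial 1 sg.
  have cz : y + c1 h *: 'e_1 @[h --> 0] --> y.
    rewrite -[X in _ --> X]addr0 -(scale0r 'e_1).
    by apply: cvgD; [exact: cvg_cst|exact: (cvgZ c1_0 (cvg_cst _))].
  exact: (cvg_comp _ _ cz (cg y)).
have T0 : partial 0 g (y1 h + c0 h *: 'e_0) @[h --> 0] --> partial 0 g y.
  have /smooth_continuous cg := smooth_partial 0 sg.
  have cz : y1 h + c0 h *: 'e_0 @[h --> 0] --> y.
    rewrite -[X in _ --> X]addr0 -(scale0r 'e_0).
    by apply: cvgD; [exact: cy1|exact: (cvgZ c0_0 (cvg_cst _))].
  exact: (cvg_comp _ _ cz (cg y)).
have T := cvgD (cvgM (cvg_cst (v 0 0)) T0) (cvgM (cvg_cst (v 0 1)) T1).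
have T' : v 0 0 * partial 0 g (y1 h + c0 h *: 'e_0) +
    v 0 1 * partial 1 g (y + c1 h *: 'e_1) @[h --> 0^'] --> along v g y.
  by apply: cvg_within_filter; exact: T.
apply: cvg_trans T'; apply: near_eq_cvg; near=> h.
have h0 : h != 0 by near: h; exact: nbhs_dnbhs_neq.
have -> : y + h *: v = y1 h + (h * v 0 0) *: 'e_0.
  by rewrite /y1 {1}(rV2E v) scalerDr !scalerA addrAC addrA.
rewrite -[g (_ + _) - g y](subrKA (g (y1 h))) (c0P h).2 (c1P h).2.
rewrite /along /GRing.scale/=.
by move: (partial 0 g _) (partial 1 g _) => a b; field.
Unshelve. all: end_near. Qed.

Lemma is_derive_line g x v t : smooth g ->
  is_derive t 1 (fun t => g (x + t *: v)) (along v g (x + t *: v)).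
Proof.
move=> sg; have C := @cvg_along g (x + t *: v) v sg.
have C' : h^-1 *: ((g \o shift (x + t *: v)) (h *: v) - g (x + t *: v))
    @[h --> 0^'] --> along v g (x + t *: v).
  rewrite (_ : (fun h : R => _) = fun h : R => h^-1 *: (g (x + t *: v + h *: v) - g (x + t *: v))).
    exact: C.
  by apply/funext => h /=; congr (_ *: (g _ - _)); rewrite addrC.
have d : derivable g (x + t *: v) v by apply/cvg_ex; exists (along v g (x + t *: v)).
apply: (is_derive_eq (is_derive_along d)).
exact/cvg_lim.
Qed.

End Plane.

(** * Rapidly decreasing functions *)

Section Rapid.
Context {R : realType}.
Implicit Types (g f : 'rV[R]_2 -> R) (x y z v e : 'rV[R]_2) (t : R) (i : 'I_2).

(** The weight [1 + |x|^2]. *)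
Definition japanese x : R := 1 + dotv x x.

Lemma dotvE x y : dotv x y = x 0 0 * y 0 0 + x 0 1 * y 0 1.
Proof.
rewrite /dotv 2!big_ord_recl big_ord0 addr0.
by rewrite (_ : lift ord0 ord0 = 1)//; exact/val_inj.
Qed.

Lemma dotv_ge0 x : 0 <= dotv x x.
Proof. by rewrite dotvE -!expr2 addr_ge0 ?sqr_ge0. Qed.

Lemma japanese_ge1 x : 1 <= japanese x.
Proof. by rewrite lerDl dotv_ge0. Qed.

Lemma japanese_gt0 x : 0 < japanese x.
Proof. exact: lt_le_trans (japanese_ge1 x). Qed.

Lemma japanese_scale t v : japanese (t *: v) = 1 + t ^+ 2 * dotv v v.
Proof. by rewrite /japanese !dotvE !mxE; ring. Qed.

(** Peetre's inequality. *)
Lemma japanese_peetre x y : japanese y <= 2 * japanese x * japanese (x + y).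
Proof.
have jx := dotv_ge0 x; have jxy := dotv_ge0 (x + y).
suff h : dotv y y <= 2 * dotv x x + 2 * dotv (x + y) (x + y).
  rewrite /japanese; have := mulr_ge0 jx jxy; lra.
rewrite !dotvE !mxE; have := sqr_ge0 (x 0 0 + (x 0 0 + y 0 0)).
have := sqr_ge0 (x 0 1 + (x 0 1 + y 0 1)); nra.
Qed.

(** Smooth functions all of whose derivatives decrease faster than any power of
    the weight. *)
Definition rapid g : Prop := smooth g /\
  forall s N, exists C, forall x, `|partials s g x| * japanese x ^+ N <= C.

Lemma rapid_smooth g : rapid g -> smooth g.
Proof. by case. Qed.

Lemma rapid_partial g i : rapid g -> rapid (partial i g).
Proof.
move=> [sg dg]; split; first exact: smooth_partial.
by move=> s N; rewrite partials_rcons; exact: dg.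
Qed.

Lemma rapid_partials g s : rapid g -> rapid (partials s g).
Proof. by move=> rg; elim: s => [//|i s IH]; exact: rapid_partial IH. Qed.

Lemma rapidD g f : rapid g -> rapid f -> rapid (fun x => g x + f x).
Proof.
move=> [sg dg] [sf df]; split; first exact: smoothD.
move=> s N; have [C gC] := dg s N; have [D fD] := df s N.
exists (C + D) => x; rewrite partialsD//; apply: le_trans (lerD (gC x) (fD x)).
by rewrite -mulrDl ler_wpM2r ?ler_normD// exprn_ge0// ltW// japanese_gt0.
Qed.

Lemma rapidZ k g : rapid g -> rapid (fun x => k * g x).
Proof.
move=> [sg dg]; split; first exact: smoothZ.
move=> s N; have [C gC] := dg s N.
by exists (`|k| * C) => x; rewrite partialsZ// normrM -mulrA ler_wpM2l.
Qed.

Lemma rapid_along v g : rapid g -> rapid (along v g).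
Proof. by move=> rg; apply: rapidD; apply: rapidZ; exact: rapid_partial. Qed.

Lemma rapid_bound g N : rapid g ->
  exists2 C, 0 <= C & forall x, `|g x| <= C / japanese x ^+ N.
Proof.
move=> [_ /(_ [::] N)[C gC]]; exists C.
  by rewrite (le_trans _ (gC 0))// mulr_ge0// exprn_ge0// ltW// japanese_gt0.
by move=> x; rewrite ler_pdivlMr ?exprn_gt0 ?japanese_gt0//; exact: gC.
Qed.

Lemma schwartz_rapid g : schwartz g -> rapid g.
Proof.
move=> [sg dg]; split=> // s N.
suff : forall a b : nat, exists C, forall x,
    `|x 0 0 ^+ a * x 0 1 ^+ b * partials s g x| * japanese x ^+ N <= C.
  by move=> /(_ 0 0)[C gC]; exists C => x; have := gC x; rewrite !expr0 !mul1r.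
(* [1 + |x|^2] is a sum of three monomials *)
elim: N => [|N IH] a b.
  have [C gC] := dg (fun i => if i == 0 then a else b) s; exists C => x.
  have := gC x; rewrite 2!big_ord_recl big_ord0 /= !mulr1.
  by rewrite (_ : lift ord0 ord0 = 1)//; exact/val_inj.
have [C0 h0] := IH a b; have [C1 h1] := IH a.+2 b; have [C2 h2] := IH a b.+2.
exists (C0 + (C1 + C2)) => x; apply: le_trans (lerD (h0 x) (lerD (h1 x) (h2 x))).
have sq (c y : R) : `|c ^+ 2 * y| = c ^+ 2 * `|y|.
  by rewrite normrM ger0_norm// sqr_ge0.
have -> : x 0 0 ^+ a.+2 * x 0 1 ^+ b * partials s g x =
  x 0 0 ^+ 2 * (x 0 0 ^+ a * x 0 1 ^+ b * partials s g x) by rewrite !exprS; ring.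
have -> : x 0 0 ^+ a * x 0 1 ^+ b.+2 * partials s g x =
  x 0 1 ^+ 2 * (x 0 0 ^+ a * x 0 1 ^+ b * partials s g x) by rewrite !exprS; ring.
rewrite !sq exprS {1}/japanese dotvE.
move: `|_| (japanese x ^+ N) => p q; rewrite le_eqVlt; apply/orP; left; apply/eqP.
ring.
Qed.

Lemma rapid_vanishing g : rapid g -> vanishing_derivatives g.
Proof.
move=> rg s e e0.
have [C C0 gC] := rapid_bound 1 (rapid_partials s rg).
exists (C / e + 1) => x; rewrite /enorm => xM.
have ce0 : 0 <= C / e by rewrite divr_ge0// ltW.
apply: (le_lt_trans (gC x)); rewrite expr1 ltr_pdivrMr ?japanese_gt0//.
have s0 : 0 <= Num.sqrt (dotv x x) by exact: sqrtr_ge0.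
have : C / e < japanese x.
  rewrite /japanese -(sqr_sqrtr (dotv_ge0 x)); nra.
by rewrite ltr_pdivrMr// mulrC.
Qed.

Lemma rapid_line_bound g : rapid g -> exists2 C, 0 <= C & forall x v t,
  `|g (x + t *: v)| <= C * japanese x / japanese (t *: v).
Proof.
move=> rg; have [C C0 gC] := rapid_bound 1 rg; exists (C * 2).
  by rewrite mulr_ge0.
move=> x v t; apply: (le_trans (gC _)).
rewrite expr1 ler_pdivrMr ?japanese_gt0// mulrAC ler_pdivlMr ?japanese_gt0//.
have := ler_wpM2l C0 (japanese_peetre x (t *: v)); lra.
Qed.

Lemma cauchyw_scale (d : R) t : 0 < d ->
  (1 + t ^+ 2 * d)^-1 <= (1 + d^-1) * cauchyw t.
Proof.
move=> d0; have t0 := sqr_ge0 t.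
have D0 : 0 < 1 + t ^+ 2 * d by rewrite ltr_wpDr// mulr_ge0// ltW.
rewrite -[leLHS]mul1r ler_pdivrMr// mulrAC ler_pdivlMr// mul1r /oneDsqr.
have i0 : 0 < d^-1 by rewrite invr_gt0.
have E : d^-1 * (t ^+ 2 * d) = t ^+ 2 by rewrite mulrCA mulVf ?mulr1// gt_eqF.
have td : 0 <= t ^+ 2 * d by rewrite mulr_ge0// ltW.
rewrite mulrDl mul1r mulrDr mulr1 E; lra.
Qed.

Lemma continuous_along_line g x v : smooth g -> continuous (fun t => g (x + t *: v)).
Proof.
move=> /smooth_continuous cg t.
exact: (cvg_comp _ _ (@continuous_affine _ _ x v t) (cg (x + t *: v))).
Qed.

Lemma rapid_line_dominated g x v : rapid g -> 0 < dotv v v ->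
  cauchy_dominated (fun t => g (x + t *: v)).
Proof.
move=> rg v0; split; first exact: continuous_along_line (rapid_smooth rg).
have [C C0 gC] := rapid_line_bound rg.
exists (C * japanese x * (1 + (dotv v v)^-1)) => t; apply: (le_trans (gC x v t)).
rewrite -[leRHS]mulrA ler_wpM2l ?mulr_ge0 ?(ltW (japanese_gt0 _))//.
by rewrite japanese_scale cauchyw_scale.
Qed.

End Rapid.

(** * Antiderivatives along rays *)

Section HalfLine.
Context {R : realType}.
Implicit Types (g f : 'rV[R]_2 -> R) (x y z v e : 'rV[R]_2) (t : R) (i : 'I_2).
Local Notation mu := (@lebesgue_measure R).

(** Integral of [g] over the half-line issued from [x] in the direction [e]. *)
Definition half e g x : R := \int[mu]_(t in `[0, +oo[) g (x + t *: e).

Lemma dotvN x : dotv (- x) (- x) = dotv x x.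
Proof. by rewrite !dotvE !mxE; ring. Qed.

Lemma japaneseN x : japanese (- x) = japanese x.
Proof. by rewrite /japanese dotvN. Qed.

Lemma ord2P i : i = 0 \/ i = 1.
Proof. by case: i => [[|[|//]] ?]; [left|right]; exact/val_inj. Qed.

Lemma dotv_delta i : dotv (delta_mx 0 i) (delta_mx 0 i : 'rV[R]_2) = 1.
Proof.
by rewrite dotvE !mxE; have [->|->] := ord2P i; rewrite /= !(mulr0, mulr1, addr0, add0r).
Qed.

Lemma dotv_delta01 : dotv ('e_0 : 'rV[R]_2) 'e_1 = 0.
Proof. by rewrite dotvE !mxE /= mulr0 mul0r addr0. Qed.

Lemma dotv_delta10 : dotv ('e_1 : 'rV[R]_2) 'e_0 = 0.
Proof. by rewrite dotvE !mxE /= mulr0 mul0r addr0. Qed.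

Lemma rapid_half_integrable g e x : rapid g -> dotv e e = 1 ->
  mu.-integrable `[0, +oo[ (EFin \o (fun t => g (x + t *: e))).
Proof.
move=> rg e1; apply: cauchy_dominated_integrable => //.
by apply: rapid_line_dominated => //; rewrite e1.
Qed.

Lemma Rintegral_line g e x : rapid g -> dotv e e = 1 ->
  \int[mu]_t g (x + t *: e) = half e g x + half (- e) g x.
Proof.
move=> rg e1; have de : cauchy_dominated (fun t => g (x + t *: e)).
  by apply: rapid_line_dominated => //; rewrite e1.
rewrite Rintegral_setT_half// RintegralD//.
- congr (_ + _); apply: eq_Rintegral => t _.
  by rewrite scalerN scaleNr.
- exact: (rapid_half_integrable x rg e1).
- by apply: cauchy_dominated_integrable => //; exact: (cauchy_dominatedN de).
Qed.

Lemma halfD e g f x : rapid g -> rapid f -> dotv e e = 1 ->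
  half e (fun x => g x + f x) x = half e g x + half e f x.
Proof.
move=> rg rf e1; have ig := rapid_half_integrable x rg e1.
by have jf := rapid_half_integrable x rf e1; rewrite /half RintegralD.
Qed.

Lemma halfZ e k g x : rapid g -> dotv e e = 1 ->
  half e (fun x => k * g x) x = k * half e g x.
Proof. by move=> rg e1; have ig := rapid_half_integrable x rg e1; rewrite /half RintegralZl. Qed.

(** Differentiation under the integral sign. *)
Lemma cvg_half_partial e g i x : rapid g -> dotv e e = 1 ->
  h^-1 *: (half e g (h *: delta_mx 0 i + x) - half e g x) @[h --> 0^'] -->
  half e (partial i g) x.
Proof.
move=> rg e1; have [sg _] := rg.
have rp := rapid_partial i rg; have [C C0 gC] := rapid_line_bound rp.
pose p (s t : R) := g (x + t *: e + s *: delta_mx 0 i).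
have dp (s t : R) : is_derive s 1 (p ^~ t) (partial i g (x + t *: e + s *: delta_mx 0 i)).
  by apply: is_derive_along; exact: smooth_derivable.
have d1 s t : partial1of2 p s t = partial i g (x + s *: delta_mx 0 i + t *: e).
  by rewrite partial1of2E addrAC; exact: (@derive_val _ _ _ _ _ _ _ (dp s t)).
have pE (s t : R) : p s t = g (x + s *: delta_mx 0 i + t *: e).
  by rewrite /p addrAC.
have ip (s : R) : mu.-integrable `[0, +oo[ (EFin \o p s).
  apply: (eq_integrable _ _ _ _ (rapid_half_integrable (x + s *: delta_mx 0 i) rg e1)) => // t _ /=.
  by rewrite pE.
pose K := C * (4 * japanese x).
have K0 : 0 <= K by rewrite !mulr_ge0// ltW// japanese_gt0.
have bound (s t : R) : `]-1, 1[%classic s -> `[0, +oo[%classic t ->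
    `|partial1of2 p s t| <= K * cauchyw t.
  rewrite /= in_itv/= => /andP[s1 s2] _; rewrite d1.
  apply: (le_trans (gC _ _ _)); rewrite japanese_scale e1 mulr1.
  rewrite ler_wpM2r ?cauchyw_ge0// ler_wpM2l//.
  have := japanese_peetre (- (s *: delta_mx 0 i)) (x + s *: delta_mx 0 i).
  rewrite [- _ + _]addrC addrK japaneseN => h.
  apply: (le_trans h).
  have : japanese (s *: delta_mx 0 i : 'rV[R]_2) <= 2.
    by rewrite japanese_scale dotv_delta; nra.
  have := japanese_gt0 x; rewrite /japanese; nra.
have iK : mu.-integrable `[0, +oo[ (EFin \o (fun t => K * cauchyw t)).
  by apply: cauchy_dominated_integrable => //; exact: cauchy_dominatedZ cauchy_dominated_cauchyw.
have E (s : R) : half e g (s *: delta_mx 0 i + x) = \int[mu]_(t in `[0, +oo[) p s t.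
  by apply: eq_Rintegral => t _; rewrite pE [x + _]addrC.
have -> : half e (partial i g) x = \int[mu]_(t in `[0, +oo[) partial1of2 p 0 t.
  by apply: eq_Rintegral => t _; rewrite d1 scale0r addr0.
have -> : half e g x = \int[mu]_(t in `[0, +oo[) p 0 t.
  by rewrite -E scale0r add0r.
rewrite (_ : (fun s : R => _) = (fun s => s^-1 *:
    (\int[mu]_(t in `[0, +oo[) p (s + 0) t - \int[mu]_(t in `[0, +oo[) p 0 t))); last first.
  by apply/funext => s; rewrite E addr0.
apply: (@cvg_differentiation_under_integral R _ _ mu p `[0, +oo[ (measurable_itv _)
  0 (-1) 1 _ (fun s _ => ip s) _ (fun t => K * cauchyw t) _ iK bound).
- by rewrite /= in_itv/=; lra.
- by move=> s t _ _; have := dp s t; case.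
- by move=> t; rewrite mulr_ge0// cauchyw_ge0.
Qed.

Lemma half_along e g x : rapid g -> dotv e e = 1 ->
  half e (along e g) x = - g x.
Proof.
move=> rg e1; have [sg _] := rg.
have ra := rapid_along e rg.
rewrite -[RHS]add0r -[in RHS](addr0 x) -[in RHS](scale0r e).
apply: (@Rintegral_cauchy_dominated R _ (fun t => g (x + t *: e)) 0).
- by apply: rapid_line_dominated => //; rewrite e1.
- by move=> t _; exact: is_derive_line.
- by apply: cauchy_dominated_cvgy; apply: rapid_line_dominated => //; rewrite e1.
Qed.

End HalfLine.

Section LineNull.
Context {R : realType}.
Implicit Types (g f : 'rV[R]_2 -> R) (x y z v e : 'rV[R]_2) (t : R) (i : 'I_2).
Local Notation mu := (@lebesgue_measure R).

(** All line integrals of [g] in the direction [e] vanish. *)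
Definition line_null e g : Prop := forall x, \int[mu]_t g (x + t *: e) = 0.

Lemma derivable_half e g i x : rapid g -> dotv e e = 1 ->
  derivable (half e g) x (delta_mx 0 i).
Proof.
move=> rg e1; apply/cvg_ex; exists (half e (partial i g) x).
exact: cvg_half_partial.
Qed.

Lemma partial_half e g i : rapid g -> dotv e e = 1 ->
  partial i (half e g) = half e (partial i g).
Proof.
move=> rg e1; apply/funext => x; apply/cvg_lim => //; exact: cvg_half_partial.
Qed.

Lemma dotvNN e : dotv e e = 1 -> dotv (- e) (- e) = 1.
Proof. by rewrite dotvN. Qed.

Lemma line_nullE e g x : rapid g -> dotv e e = 1 -> line_null e g ->
  half (- e) g x = - half e g x.
Proof.
by move=> rg e1 /(_ x); rewrite Rintegral_line// addrC => /eqP; rewrite addr_eq0 => /eqP.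
Qed.

Lemma line_null_partial e g i : rapid g -> dotv e e = 1 ->
  line_null e g -> line_null e (partial i g).
Proof.
move=> rg e1 n x; have e1' := dotvNN e1.
have rp := rapid_partial i rg.
rewrite Rintegral_line// -(partial_half i rg e1) -(partial_half i rg e1').
have -> : half (- e) g = - half e g by apply/funext => y; exact: line_nullE.
by rewrite /partial deriveN ?subrr//; exact: derivable_half.
Qed.

Lemma line_null_partials e g s : rapid g -> dotv e e = 1 ->
  line_null e g -> line_null e (partials s g).
Proof.
move=> rg e1 n; elim: s => [//|i s IH].
exact: (line_null_partial i (rapid_partials s rg) e1 IH).
Qed.

(** If [x] makes an acute angle with [e], the weight only grows along the
    half-line from [x] in the direction [e]. *)
Lemma half_decay e g N : rapid g -> dotv e e = 1 ->
  exists C, forall x, 0 <= dotv x e -> `|half e g x| * japanese x ^+ N <= C.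
Proof.
move=> rg e1; have [C C0 gC] := rapid_bound N.+1 rg.
exists (C * (pi / 2)) => x xe.
have jx := japanese_gt0 x; have jxN : 0 < japanese x ^+ N by rewrite exprn_gt0.
have dw : cauchy_dominated (fun t => C / japanese x ^+ N * cauchyw t).
  exact: cauchy_dominatedZ cauchy_dominated_cauchyw.
have iw := cauchy_dominated_integrable (measurable_itv `[0, +oo[) dw.
have ig := rapid_half_integrable x rg e1.
rewrite -ler_pdivlMr// -Rintegral_cauchyw_half mulrAC -RintegralZl//; last first.
  exact: cauchy_dominated_integrable cauchy_dominated_cauchyw.
apply: (le_trans (le_normr_Rintegral _ ig)) => //.
apply: le_Rintegral => //.
  exact: integrable_norm.
move=> t; rewrite /= in_itv/= andbT => t0.
apply: (le_trans (gC _)); rewrite -mulrA ler_wpM2l//.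
rewrite -invfM lef_pV2 ?posrE ?mulr_gt0 ?exprn_gt0 ?japanese_gt0//.
have E : japanese (x + t *: e) = japanese x + (2 * t * dotv x e + t ^+ 2).
  have -> : t ^+ 2 = t ^+ 2 * dotv e e by rewrite e1 mulr1.
  by rewrite /japanese !dotvE !mxE; ring.
have te : 0 <= t * dotv x e by rewrite mulr_ge0.
rewrite exprSr ler_pM ?exprn_ge0 ?(ltW jx)//.
- rewrite lerXn2r ?nnegrE ?(ltW (japanese_gt0 _))// E lerDl.
  by have := sqr_ge0 t; lra.
- by rewrite E /oneDsqr; have := japanese_ge1 x; lra.
Qed.

(** When the line integrals vanish, the two half-lines from [x] give opposite
    integrals; one of them leads away from the origin. *)
Lemma half_null_decay e g N : rapid g -> dotv e e = 1 -> line_null e g ->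
  exists C, forall x, `|half e g x| * japanese x ^+ N <= C.
Proof.
move=> rg e1 n; have [C hC] := half_decay N rg e1.
have [D hD] := half_decay N rg (dotvNN e1).
exists (Num.max C D) => x; rewrite le_max.
have [xe|xe] := leP 0 (dotv x e); first by rewrite hC.
rewrite -normrN -(line_nullE x rg e1 n) hD ?orbT//.
by have -> : dotv x (- e) = - dotv x e; [rewrite !dotvE !mxE; ring|lra].
Qed.

(** Bounded partial derivatives make a function Lipschitz, hence continuous. *)
Lemma bounded_partials_continuous f (M : R) :
  (forall i x, derivable f x (delta_mx 0 i)) ->
  (forall i x, `|partial i f x| <= M) -> continuous f.
Proof.
move=> d h.
have lip x y : `|f x - f y| <= `|(x - y) 0 0| * M + `|(x - y) 0 1| * M.
  have [c0 _ E0] := partial_MVT (y + (x - y) 0 1 *: delta_mx 0 1) ((x - y) 0 0) (d 0).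
  have [c1 _ E1] := partial_MVT y ((x - y) 0 1) (d 1).
  have -> : f x - f y =
    (f (y + (x - y) 0 1 *: delta_mx 0 1 + (x - y) 0 0 *: delta_mx 0 0)
      - f (y + (x - y) 0 1 *: delta_mx 0 1)) +
    (f (y + (x - y) 0 1 *: delta_mx 0 1) - f y).
    by rewrite subrKA -addrA [_ *: _ + _]addrC -rV2E addrC subrK.
  rewrite E0 E1; apply: (le_trans (ler_normD _ _)).
  by apply: lerD; rewrite normrM; apply: ler_wpM2l => //; exact: h.
move=> x; have cc j : `|(x - u) 0 j| @[u --> x] --> (0 : R).
  have c : (x - u) 0 j @[u --> x] --> (0 : R).
    have c : (u : 'rV[R]_2) 0 j @[u --> x] --> x 0 j by exact: coord_continuous.
    rewrite (_ : (fun u : 'rV[R]_2 => (x - u) 0 j) = fun u : 'rV[R]_2 => x 0 j - u 0 j).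
      by have := cvgB (cvg_cst (x 0 j)) c; rewrite subrr; apply.
    by apply/funext => u; rewrite !mxE.
  by have := cvg_norm c; rewrite normr0; apply.
have L : `|(x - u) 0 0| * M + `|(x - u) 0 1| * M @[u --> x] --> (0 : R).
  have := cvgD (cvgM (cc 0) (cvg_cst M)) (cvgM (cc 1) (cvg_cst M)).
  by rewrite !mul0r addr0; apply.
apply/(@cvgrPdist_le _ _ _ (nbhs x) (nbhs_filter x) f) => eps eps0; near=> y.
apply: (le_trans (lip x y)); apply: (le_trans (ler_norm _)).
near: y; exact: (cvgr0_norm_le _ L _ eps0).
Unshelve. all: end_near. Qed.

Lemma continuous_half e g : rapid g -> dotv e e = 1 -> line_null e g ->
  continuous (half e g).
Proof.
move=> rg e1 n.
have bnd i : exists M, forall x, `|partial i (half e g) x| <= M.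
  have [M hM] := half_null_decay 0 (rapid_partial i rg) e1 (line_null_partial i rg e1 n).
  by exists M => x; have := hM x; rewrite mulr1 partial_half.
have [M0 h0] := bnd 0; have [M1 h1] := bnd 1.
apply: (@bounded_partials_continuous _ (Num.max M0 M1)).
  by move=> i y; exact: derivable_half.
move=> i x; rewrite le_max; apply/orP.
by have [->|->] := ord2P i; [left; exact: h0|right; exact: h1].
Qed.

Lemma rapid_half e g : rapid g -> dotv e e = 1 -> line_null e g ->
  rapid (half e g).
Proof.
move=> rg e1 n.
have P s : partials s (half e g) = half e (partials s g).
  elim: s => [//|i s IH]; rewrite /= -/(partials s _) IH.
  exact: (partial_half i (rapid_partials s rg) e1).
split=> s.
  have rs := rapid_partials s rg; have ns := line_null_partials s rg e1 n.
  rewrite P; split; first exact: continuous_half.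
  by move=> i x; exact: derivable_half.
move=> N; rewrite P.
exact: half_null_decay (rapid_partials s rg) e1 (line_null_partials s rg e1 n).
Qed.

Lemma along_half e g x : rapid g -> dotv e e = 1 -> along e (half e g) x = - g x.
Proof.
move=> rg e1; rewrite -(half_along x rg e1) /along !partial_half//.
have r0 := rapid_partial 0 rg; have r1 := rapid_partial 1 rg.
by rewrite -!halfZ// -halfD//; exact: rapidZ.
Qed.

End LineNull.

Section Antiderivative.
Context {R : realType}.
Implicit Types (g f p : 'rV[R]_2 -> R) (x z v e : 'rV[R]_2) (i : 'I_2).
Local Notation mu := (@lebesgue_measure R).

(** Bound over a plane with orthogonal coordinates [s] and [t], the two
    coordinate vectors of which have squared length [d]. *)
Lemma rapid_plane_bound g (d : R) x : rapid g -> 0 < d -> exists2 K, 0 <= K &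
  forall z (s t : R), japanese z = 1 + s ^+ 2 * d + t ^+ 2 * d ->
    `|g (x + z)| <= K * (cauchyw s * cauchyw t).
Proof.
move=> rg d0; have [C C0 gC] := rapid_bound 2 rg.
pose k := 1 + d^-1; have k0 : 0 <= k by rewrite addr_ge0// invr_ge0 ltW.
have jx := japanese_gt0 x.
exists (C * (2 * japanese x) ^+ 2 * k ^+ 2).
  by rewrite mulr_ge0 ?sqr_ge0// mulr_ge0 ?sqr_ge0.
move=> z s t Ez; apply: (le_trans (gC _)).
have jz := japanese_gt0 z; have jxz := japanese_gt0 (x + z).
have h1 : (japanese (x + z) ^+ 2)^-1 <= (2 * japanese x) ^+ 2 / japanese z ^+ 2.
  rewrite ler_pdivlMr ?exprn_gt0// mulrC ler_pdivrMr ?exprn_gt0// -exprMn.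
  by rewrite lerXn2r ?nnegrE ?japanese_peetre// ltW// !mulr_gt0.
rewrite -[_ * k ^+ 2]mulrA -[leRHS]mulrA ler_wpM2l//.
rewrite -[leRHS]mulrA; apply: (le_trans h1).
rewrite ler_wpM2l ?exprn_ge0 ?mulr_ge0 ?(ltW jx)//.
have sd0 : 0 <= s ^+ 2 * d by rewrite mulr_ge0 ?sqr_ge0 ?(ltW d0).
have td0 : 0 <= t ^+ 2 * d by rewrite mulr_ge0 ?sqr_ge0 ?(ltW d0).
have sd : 0 < 1 + s ^+ 2 * d by rewrite ltr_wpDr// mulr_ge0 ?sqr_ge0 ?(ltW d0).
have td : 0 < 1 + t ^+ 2 * d by rewrite ltr_wpDr// mulr_ge0 ?sqr_ge0 ?(ltW d0).
have h2 : (japanese z ^+ 2)^-1 <= (1 + s ^+ 2 * d)^-1 * (1 + t ^+ 2 * d)^-1.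
  rewrite -invfM lef_pV2 ?posrE ?mulr_gt0 ?exprn_gt0//.
  rewrite expr2 ler_pM ?(ltW sd) ?(ltW td)// Ez; lra.
apply: (le_trans h2); rewrite expr2 mulrACA ler_pM ?invr_ge0 ?(ltW sd) ?(ltW td)//.
  exact: cauchyw_scale.
exact: cauchyw_scale.
Qed.

Lemma continuous_plane g x v e : smooth g ->
  continuous (fun z : R * R => g (x + z.1 *: v + z.2 *: e)).
Proof.
move=> /smooth_continuous cg z.
have cz : x + u.1 *: v + u.2 *: e @[u --> z] --> x + z.1 *: v + z.2 *: e.
  apply: cvgD; last exact: (cvgZ cvg_snd (cvg_cst _)).
  by apply: cvgD; [exact: cvg_cst|exact: (cvgZ cvg_fst (cvg_cst _))].
exact: (cvg_comp _ _ cz (cg (x + z.1 *: v + z.2 *: e))).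
Qed.

(** Fubini: integrating over a line in the direction [v] and over half-lines in
    the orthogonal direction [e] can be done in either order. *)
Lemma half_null_orthogonal e v g : rapid g -> dotv e e = 1 -> dotv v v = 1 ->
  dotv e v = 0 -> line_null v g -> line_null v (half e g).
Proof.
move=> rg e1 v1 ev nv x.
pose D : set R := `[0, +oo[%classic.
have mD : measurable D by exact: measurable_itv.
pose F (z : R * R) := g (x + z.1 *: v + z.2 *: e) * \1_D z.2.
have mF : measurable_fun setT F.
  have m1 := measurable_continuous2 (@continuous_plane _ x v e (rapid_smooth rg)).
  have m2 : measurable_fun [set: R] (\1_D : R -> R) by exact: measurable_indic.
  have m3 := measurableT_comp m2 (@measurable_snd _ _ R R).
  exact: (measurable_funM m1 m3).
have [K K0 gK] := rapid_plane_bound x rg ltr01.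
have FK s t : `|F (s, t)| <= (K * cauchyw s) * cauchyw t.
  rewrite -mulrA; apply: (@le_trans _ _ `|g (x + (s *: v + t *: e))|).
    rewrite /F /= addrA normrM ler_piMr// indicE.
    by case: (_ \in _); rewrite ?normr1 ?normr0.
  apply: gK; rewrite /japanese.
  have -> : dotv (s *: v + t *: e) (s *: v + t *: e) =
    s ^+ 2 * dotv v v + t ^+ 2 * dotv e e + 2 * s * t * dotv e v.
    by rewrite !dotvE !mxE; ring.
  by rewrite ev v1 e1; ring.
have iK : mu.-integrable setT (EFin \o (fun s => K * cauchyw s)).
  apply: cauchy_dominated_integrable => //.
  exact: cauchy_dominatedZ cauchy_dominated_cauchyw.
have iw := @integrable_cauchyw R.
transitivity (\int[mu]_s \int[mu]_t F (s, t)).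
  apply: eq_Rintegral => s _; rewrite /half Rintegral_mkcond.
  apply: eq_Rintegral => t _; rewrite /F/= patchE indicE.
  by rewrite -/D; case: (t \in D); rewrite ?mulr1 ?mulr0.
transitivity (\int[mu]_t \int[mu]_s F (s, t)).
  exact: (@Rintegral_Fubini R _ _ _ _ mu mu F (fun s => K * cauchyw s) cauchyw).
have F0 t : \int[mu]_s F (s, t) = 0.
  transitivity (\int[mu]_s (g (x + t *: e + s *: v) * \1_D t)).
    by apply: eq_Rintegral => s _; rewrite /F/= addrAC.
  rewrite RintegralZr ?nv ?mul0r//.
  apply: cauchy_dominated_integrable => //.
  by apply: rapid_line_dominated => //; rewrite v1.
under eq_Rintegral => t _ do rewrite F0.
by rewrite Rintegral_cst// mul0r.
Qed.

(** The antiderivative is minus the integral over the half-line. *)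
Lemma antiderivative e g : rapid g -> dotv e e = 1 -> line_null e g ->
  exists p, [/\ rapid p, forall x, along e p x = g x &
    forall v, dotv v v = 1 -> dotv e v = 0 -> line_null v g -> line_null v p].
Proof.
move=> rg e1 n; have rh := rapid_half rg e1 n.
exists (fun x => -1 * half e g x); split; first exact: rapidZ.
- move=> x; have := along_half x rg e1.
  rewrite /along !partialZ; [|exact: rapid_smooth|exact: rapid_smooth].
  move: (partial 0 (half e g) x) (partial 1 (half e g) x) (g x) (e 0 0) (e 0 1).
  by move=> a b c d k h; rewrite !mulN1r !mulrN -opprD h opprK.
- move=> v v1 ev nv x; have hn := half_null_orthogonal rg e1 v1 ev nv.
  rewrite RintegralZl ?hn ?mulr0//.
  apply: cauchy_dominated_integrable => //.
  by apply: rapid_line_dominated => //; rewrite v1.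
Qed.

(** Rescaling the direction. *)
Lemma line_null_scale e g (c : R) : rapid g -> dotv e e = 1 -> c != 0 ->
  line_null e g -> line_null (c *: e) g.
Proof.
(* instead of a change of variables, use the antiderivative on the new line *)
move=> rg e1 c0 n x; have [p [rp pE _]] := antiderivative rg e1 n.
have ce : 0 < dotv (c *: e) (c *: e).
  have -> : dotv (c *: e) (c *: e) = c ^+ 2 * dotv e e by rewrite !dotvE !mxE; ring.
  by rewrite e1 mulr1 exprn_even_gt0.
have dp : cauchy_dominated (fun t => c^-1 * p (x + t *: (c *: e))).
  by apply: cauchy_dominatedZ; exact: rapid_line_dominated.
apply: (@Rintegral_setT_eq0 R _ (fun t => c^-1 * p (x + t *: (c *: e)))).
- exact: rapid_line_dominated.
- move=> t.
  have := is_deriveZ c^-1 (@is_derive_line _ p x (c *: e) t (rapid_smooth rp)).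
  move=> h; apply: (is_derive_eq h); rewrite -pE /along !mxE -!mulrA -mulrDr.
  exact: mulKf.
- exact: cauchy_dominated_cvgy.
- exact: cauchy_dominated_cvgNy.
Qed.

(** A rapidly decreasing function whose line integrals vanish in all directions
    off the coordinate axes and the diagonals is zero. *)
Lemma ray_injective g : rapid g ->
  (forall e, dotv e e = 1 -> e 0 0 * e 0 1 * (e 0 0 ^+ 2 - e 0 1 ^+ 2) != 0 ->
     line_null e g) ->
  forall x, g x = 0.
Proof.
move=> rg n x.
pose psi (z : R * R) := g (0 + z.1 *: 'e_0 + z.2 *: 'e_1).
suff h : forall w, psi w = 0.
  by have := h (x 0 0, x 0 1); rewrite /psi add0r -rV2E.
have [M _ gM] := rapid_bound 0 rg.
apply: (@radon_injective R psi M).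
- exact: continuous_plane (rapid_smooth rg).
- by move=> z; have := gM (0 + z.1 *: 'e_0 + z.2 *: 'e_1); rewrite expr0 divr1.
- move=> eps x0 y0 eps0; have eps20 : 0 < eps ^+ 2 by rewrite exprn_gt0.
  have [K _ gK] := rapid_plane_bound (x0 *: 'e_0 + y0 *: 'e_1) rg eps20.
  exists K => s t; rewrite /psi/=.
  rewrite (_ : _ + _ = x0 *: 'e_0 + y0 *: 'e_1 + ((eps * s) *: 'e_0 + (eps * t) *: 'e_1)).
    by apply: gK; rewrite /japanese dotvE !mxE/=; ring.
  by rewrite add0r !scalerDl addrACA.
- move=> eps m x0 y0 eps0 mN; rewrite /psi/=.
  (* the unit vector in the direction of the lines of slope [m] *)
  pose r := Num.sqrt (1 + m ^+ 2).
  have m1 : 0 < 1 + m ^+ 2 by rewrite ltr_wpDr ?sqr_ge0.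
  have r0 : 0 < r by rewrite sqrtr_gt0.
  have r2 : r ^+ 2 = 1 + m ^+ 2 by rewrite sqr_sqrtr// ltW.
  pose e : 'rV[R]_2 := r^-1 *: 'e_0 + (m / r) *: 'e_1.
  have e0E : e 0 0 = r^-1 by rewrite /e !mxE/= mulr1 mulr0 addr0.
  have e1E : e 0 1 = m / r by rewrite /e !mxE/= mulr1 mulr0 add0r.
  have e1 : dotv e e = 1.
    rewrite dotvE e0E e1E; have -> : r^-1 * r^-1 + m / r * (m / r) = (1 + m ^+ 2) / r ^+ 2.
      by field; rewrite gt_eqF.
    by rewrite r2 divff// gt_eqF.
  have eN : e 0 0 * e 0 1 * (e 0 0 ^+ 2 - e 0 1 ^+ 2) != 0.
    rewrite e0E e1E.
    have -> : r^-1 * (m / r) * (r^-1 ^+ 2 - (m / r) ^+ 2) = m * (1 - m) * (1 + m) / r ^+ 4.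
      by field; rewrite gt_eqF.
    move: mN; rewrite !inE !negb_or => /and3P[m00 m10 mN1].
    rewrite mulf_neq0 ?invr_eq0 ?expf_neq0 ?(gt_eqF r0)// !mulf_neq0//.
      by rewrite subr_eq0 eq_sym.
    by rewrite addrC addr_eq0.
  have c0 : eps * r != 0 by rewrite mulf_neq0// gt_eqF.
  have := line_null_scale rg e1 c0 (n e e1 eN) (x0 *: 'e_0 + y0 *: 'e_1) => <-.
  apply: eq_Rintegral => t _; congr g.
  rewrite add0r !scalerDl addrACA; congr (_ + _).
  rewrite /e !scalerDr !scalerA; congr (_ *: _ + _ *: _).
    by field; rewrite gt_eqF.
  by field; rewrite gt_eqF.
Qed.

End Antiderivative.

(** * Elastic tensors in the plane *)

Section Contraction.
Context {R : realType}.
Implicit Types (w : tensor4 R 2) (xi zeta x : 'rV[R]_2) (g h : 'rV[R]_2 -> R).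

Lemma sum2 (F : 'I_2 -> R) : \sum_(i < 2) F i = F 0 + F 1.
Proof.
rewrite 2!big_ord_recl big_ord0 addr0.
by rewrite (_ : lift ord0 ord0 = 1)//; exact/val_inj.
Qed.

(** The pairing of a 4-tensor with the tensor square of [xi] tensor [zeta]. *)
Definition contract w xi zeta : R :=
  \sum_(i < 2) \sum_(j < 2) \sum_(k < 2) \sum_(l < 2)
    w i j k l * xi 0 i * zeta 0 j * xi 0 k * zeta 0 l.

(** The six independent components of an elastic tensor of the plane. *)
Lemma elastic2E w : elastic2 w ->
  ((w 0 0 1 0 = w 0 0 0 1) * (w 0 1 0 0 = w 0 0 0 1) * (w 1 0 0 0 = w 0 0 0 1)
   * (w 1 1 0 0 = w 0 0 1 1)
   * (w 0 1 1 0 = w 0 1 0 1) * (w 1 0 0 1 = w 0 1 0 1) * (w 1 0 1 0 = w 0 1 0 1)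
   * (w 1 0 1 1 = w 0 1 1 1) * (w 1 1 0 1 = w 0 1 1 1) * (w 1 1 1 0 = w 0 1 1 1))%type.
Proof.
move=> ew; have s1 i j k l : w i j k l = w j i k l by have [] := ew i j k l.
have s2 i j k l : w i j k l = w i j l k by have [] := ew i j k l.
have s3 i j k l : w i j k l = w k l i j by have [] := ew i j k l.
do !split.
- exact: s2.
- exact: s3.
- by rewrite s1 s3.
- exact: s3.
- exact: s2.
- exact: s1.
- by rewrite s1 s2.
- exact: s1.
- exact: s3.
- by rewrite s2 s3.
Qed.

Lemma contractE w xi zeta : elastic2 w ->
  let p := xi 0 0 * zeta 0 0 in let q := xi 0 1 * zeta 0 1 in
  let m := xi 0 0 * zeta 0 1 + xi 0 1 * zeta 0 0 in
  contract w xi zeta = w 0 0 0 0 * p ^+ 2 + 2 * w 0 0 0 1 * p * m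
    + 2 * w 0 0 1 1 * p * q + w 0 1 0 1 * m ^+ 2 + 2 * w 0 1 1 1 * q * m
    + w 1 1 1 1 * q ^+ 2.
Proof.
move=> ew; rewrite /contract !sum2 !(elastic2E ew) /=; ring.
Qed.

Lemma enorm1_dotv xi : enorm xi = 1 -> dotv xi xi = 1.
Proof.
by rewrite /enorm => h; rewrite -(sqr_sqrtr (dotv_ge0 xi)) h expr1n.
Qed.

Lemma dotv1_enorm xi : dotv xi xi = 1 -> enorm xi = 1.
Proof. by rewrite /enorm => ->; rewrite sqrtr1. Qed.

Lemma line_nullD e g h : rapid g -> rapid h -> dotv e e = 1 ->
  line_null e g -> line_null e h -> line_null e (fun x => g x + h x).
Proof.
move=> rg rh e1 ng nh x.
have dg : cauchy_dominated (fun t => g (x + t *: e)).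
  by apply: rapid_line_dominated => //; rewrite e1.
have dh : cauchy_dominated (fun t => h (x + t *: e)).
  by apply: rapid_line_dominated => //; rewrite e1.
by rewrite RintegralD ?ng ?nh ?addr0//; exact: cauchy_dominated_integrable.
Qed.

Lemma line_nullZ e k g : rapid g -> dotv e e = 1 ->
  line_null e g -> line_null e (fun x => k * g x).
Proof.
move=> rg e1 ng x; rewrite RintegralZl ?ng ?mulr0//.
apply: cauchy_dominated_integrable => //.
by apply: rapid_line_dominated => //; rewrite e1.
Qed.

Lemma line_null_along e g : rapid g -> dotv e e = 1 -> line_null e (along e g).
Proof.
move=> rg e1 x; have e0 : 0 < dotv e e by rewrite e1.
apply: (@Rintegral_setT_eq0 R _ (fun t => g (x + t *: e))).
- exact: rapid_line_dominated (rapid_along e rg) e0.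
- by move=> t; apply: is_derive_line; exact: rapid_smooth.
- exact: cauchy_dominated_cvgy (rapid_line_dominated x rg e0).
- exact: cauchy_dominated_cvgNy (rapid_line_dominated x rg e0).
Qed.

Lemma tends_to_0D g h : tends_to_0_at_infinity g -> tends_to_0_at_infinity h ->
  tends_to_0_at_infinity (fun x => g x + h x).
Proof.
move=> tg th e e0; have e2 : 0 < e / 2 by rewrite divr_gt0.
have [M gM] := tg _ e2; have [N hN] := th _ e2.
exists (Num.max M N) => x; rewrite gt_max => /andP[xM xN].
apply: (le_lt_trans (ler_normD _ _)); have := gM x xM; have := hN x xN; lra.
Qed.

Lemma tends_to_0Z k g : tends_to_0_at_infinity g ->
  tends_to_0_at_infinity (fun x => k * g x).
Proof.
move=> tg e e0; have k0 : 0 < 1 + `|k| by rewrite ltr_wpDr.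
have [M gM] := tg (e / (1 + `|k|)) (divr_gt0 e0 k0).
exists M => x /gM; rewrite normrM ltr_pdivlMr// => h.
by apply: le_lt_trans h; rewrite mulrC ler_wpM2l// lerDr.
Qed.

Lemma tends_to_0_line g x xi : tends_to_0_at_infinity g -> dotv xi xi = 1 ->
  g (x + t *: xi) @[t --> +oo] --> (0 : R).
Proof.
move=> tg xi1; apply/cvgr0Pnorm_lt => e e0.
have [M gM] := tg e e0; near=> t; apply: gM.
have Mt : 0 <= Num.max M 0 by rewrite le_max lexx orbT.
apply: (@le_lt_trans _ _ (Num.max M 0)); first by rewrite le_max lexx.
have Et : dotv (x + t *: xi) (x + t *: xi) = dotv x x + 2 * t * dotv x xi + t ^+ 2.
  have -> : t ^+ 2 = t ^+ 2 * dotv xi xi by rewrite xi1 mulr1.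
  by rewrite !dotvE !mxE; ring.
pose m := Num.max M 0.
have t1 : 1 + m ^+ 2 + 2 * `|dotv x xi| <= t.
  by near: t; apply: nbhs_pinfty_ge; exact: num_real.
have key : m ^+ 2 < dotv (x + t *: xi) (x + t *: xi).
  rewrite Et; have d0 := dotv_ge0 x; have c1 := ler_norm (- dotv x xi).
  rewrite normrN in c1; have c0 := normr_ge0 (dotv x xi); have m0 := sqr_ge0 m.
  move: (dotv x x) (dotv x xi) `|dotv x xi| (m ^+ 2) d0 c1 c0 m0 t1 => d c k m2 *.
  have t10 : 1 <= t by lra.
  have h1 : 1 + m2 <= t * (1 + m2) by rewrite ler_peMl//; lra.
  have h2 : t * (1 + m2) <= t * (t + 2 * c) by rewrite ler_wpM2l//; lra.
  nra.
rewrite /enorm -[ltLHS](@ger0_norm _ m)// -sqrtr_sqr ltr_sqrt//.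
exact: le_lt_trans (sqr_ge0 m) key.
Unshelve. all: end_near. Qed.

End Contraction.

Section PotentialsAreNull.
Context {R : realType}.
Implicit Types (x y xi zeta : 'rV[R]_2) (g h : 'rV[R]_2 -> R).

Lemma rapid_contract (f : 'rV[R]_2 -> tensor4 R 2) xi zeta :
  (forall i j k l, rapid (fun x => f x i j k l)) ->
  (forall x, elastic2 (f x)) -> rapid (fun x => contract (f x) xi zeta).
Proof.
move=> rf ef.
pose p := xi 0 0 * zeta 0 0; pose q := xi 0 1 * zeta 0 1.
pose m := xi 0 0 * zeta 0 1 + xi 0 1 * zeta 0 0.
rewrite (_ : (fun x => _) = fun x => p ^+ 2 * f x 0 0 0 0 + (2 * p * m * f x 0 0 0 1
  + (2 * p * q * f x 0 0 1 1 + (m ^+ 2 * f x 0 1 0 1 + (2 * q * m * f x 0 1 1 1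
  + q ^+ 2 * f x 1 1 1 1))))).
  by do 5 (apply: rapidD; first exact: rapidZ (rf _ _ _ _)); exact: rapidZ (rf _ _ _ _).
by apply/funext => x; rewrite contractE// -/p -/q -/m; ring.
Qed.

Lemma smooth_lincomb (a b : R) g h : smooth g -> smooth h ->
  smooth (fun x => a * g x + b * h x).
Proof. by move=> sg sh; exact: smoothD (smoothZ a sg) (smoothZ b sh). Qed.

Lemma partials_lincomb (a b : R) g h s : smooth g -> smooth h ->
  partials s (fun x => a * g x + b * h x) =
  fun x => a * partials s g x + b * partials s h x.
Proof.
move=> sg sh; rewrite (partialsD s (smoothZ a sg) (smoothZ b sh)).
by rewrite (partialsZ a s sg) (partialsZ b s sh).
Qed.

Lemma tends_to_0_lincomb (a b : R) g h : tends_to_0_at_infinity g ->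
  tends_to_0_at_infinity h -> tends_to_0_at_infinity (fun x => a * g x + b * h x).
Proof.
by move=> tg th; exact: tends_to_0D (tends_to_0Z a tg) (tends_to_0Z b th).
Qed.

(** The algebraic identity behind [H] and [K]: [S] stands for the second
    derivatives of [v], and [T] for the first derivatives of [u]. *)
Lemma contract_hessian_gradient (S : 'I_2 -> 'I_2 -> 'I_2 -> 'I_2 -> R)
    (T : 'I_2 -> 'I_2 -> R) xi zeta :
  (exists c : R, zeta = c *: xi) \/ dotv xi zeta = 0 ->
  let s i j := xi 0 0 * (zeta 0 0 * S i j 0 0 + zeta 0 1 * S i j 0 1) +
               xi 0 1 * (zeta 0 0 * S i j 1 0 + zeta 0 1 * S i j 1 1) in
  let t i := zeta 0 0 * T i 0 + zeta 0 1 * T i 1 in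
  let d i := 1 * (zeta 0 0 * s i 0 + zeta 0 1 * s i 1) + dotv xi zeta * t i in
  xi 0 0 * d 0 + xi 0 1 * d 1 = contract (fun i j k l =>
    2^-1 * (S i j k l + S k l i j)
    + (4^-1 * (T i j + T j i) * (k == l)%:R + 4^-1 * (T l k + T k l) * (i == j)%:R)) xi zeta.
Proof.
move=> adm s t d; rewrite /contract !sum2 /=.
have -> : d 0 = zeta 0 0 * s 0 0 + zeta 0 1 * s 0 1 + dotv xi zeta * t 0 by rewrite /d mul1r.
have -> : d 1 = zeta 0 0 * s 1 0 + zeta 0 1 * s 1 1 + dotv xi zeta * t 1 by rewrite /d mul1r.
pose e i j := 2^-1 * (T i j + T j i).
transitivity (xi 0 0 * (zeta 0 0 * s 0 0 + zeta 0 1 * s 0 1)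
  + xi 0 1 * (zeta 0 0 * s 1 0 + zeta 0 1 * s 1 1)
  + dotv xi zeta * (xi 0 0 * (zeta 0 0 * e 0 0 + zeta 0 1 * e 0 1)
    + xi 0 1 * (zeta 0 0 * e 1 0 + zeta 0 1 * e 1 1))).
  case: adm => [[c zE]|->]; rewrite /t /e; last by ring.
  by clearbody s; rewrite zE !mxE; field.
by rewrite /e /s !dotvE; field.
Qed.

Section RayPotential.
Variables (V : 'I_2 -> 'I_2 -> 'rV[R]_2 -> R) (U : 'I_2 -> 'rV[R]_2 -> R).
Variables xi zeta : 'rV[R]_2.
Hypotheses (sV : forall k l, smooth (V k l)) (sU : forall j, smooth (U j)).

Let V0 y := zeta 0 0 * V 0 0 y + zeta 0 1 * V 0 1 y.
Let V1 y := zeta 0 0 * V 1 0 y + zeta 0 1 * V 1 1 y.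
Let W y := xi 0 0 * V0 y + xi 0 1 * V1 y.
Let Y y := zeta 0 0 * U 0 y + zeta 0 1 * U 1 y.

(** A function whose derivative along [xi] is the contraction of [H v + K u]
    with [xi] and [zeta], for admissible pairs of directions. *)
Definition ray_potential y : R := 1 * along zeta W y + dotv xi zeta * Y y.

Let sV0 : smooth V0. Proof. exact: smooth_lincomb (sV 0 0) (sV 0 1). Qed.
Let sV1 : smooth V1. Proof. exact: smooth_lincomb (sV 1 0) (sV 1 1). Qed.
Let sW : smooth W. Proof. exact: smooth_lincomb sV0 sV1. Qed.
Let sY : smooth Y. Proof. exact: smooth_lincomb (sU 0) (sU 1). Qed.
Let saW : smooth (along zeta W).
Proof. exact: smooth_lincomb (smooth_partial 0 sW) (smooth_partial 1 sW). Qed.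

Let dW s : partials s W = fun y =>
  xi 0 0 * (zeta 0 0 * partials s (V 0 0) y + zeta 0 1 * partials s (V 0 1) y) +
  xi 0 1 * (zeta 0 0 * partials s (V 1 0) y + zeta 0 1 * partials s (V 1 1) y).
Proof.
rewrite (partials_lincomb (xi 0 0) (xi 0 1) s sV0 sV1).
rewrite (partials_lincomb (zeta 0 0) (zeta 0 1) s (sV 0 0) (sV 0 1)).
by rewrite (partials_lincomb (zeta 0 0) (zeta 0 1) s (sV 1 0) (sV 1 1)).
Qed.

Let dY s : partials s Y = fun y =>
  zeta 0 0 * partials s (U 0) y + zeta 0 1 * partials s (U 1) y.
Proof. exact: partials_lincomb (sU 0) (sU 1). Qed.

Lemma smooth_ray_potential : smooth ray_potential.
Proof. exact: smooth_lincomb saW sY. Qed.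

Lemma ray_potential_tends_to_0 :
  (forall k l, vanishing_derivatives (V k l)) ->
  (forall j, vanishing_derivatives (U j)) ->
  tends_to_0_at_infinity ray_potential.
Proof.
move=> tV tU.
have tW s : tends_to_0_at_infinity (partials s W).
  rewrite dW; apply: tends_to_0_lincomb; apply: tends_to_0_lincomb; exact: tV.
apply: tends_to_0_lincomb; apply: tends_to_0_lincomb.
- exact: (tW [:: 0]).
- exact: (tW [:: 1]).
- exact: (tU 0 [::]).
- exact: (tU 1 [::]).
Qed.

Let partial_ray_potential i y : partial i ray_potential y =
  1 * (zeta 0 0 * partials [:: i; 0] W y + zeta 0 1 * partials [:: i; 1] W y)
  + dotv xi zeta * partials [:: i] Y y.
Proof.
have := partials_lincomb 1 (dotv xi zeta) [:: i] saW sY.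
have := partials_lincomb (zeta 0 0) (zeta 0 1) [:: i] (smooth_partial 0 sW) (smooth_partial 1 sW).
move=> E1 E2; rewrite -[partial i ray_potential]/(partials [:: i] ray_potential).
by rewrite E2 E1.
Qed.

Lemma along_ray_potential y :
  (exists c : R, zeta = c *: xi) \/ dotv xi zeta = 0 ->
  along xi ray_potential y = contract (fun i j k l =>
    2^-1 * (partial i (partial j (V k l)) y + partial k (partial l (V i j)) y)
    + (4^-1 * (partial i (U j) y + partial j (U i) y) * (k == l)%:R
       + 4^-1 * (partial l (U k) y + partial k (U l) y) * (i == j)%:R)) xi zeta.
Proof.
move=> adm.
rewrite -(contract_hessian_gradient (fun i j k l => partial i (partial j (V k l)) y)
  (fun i j => partial i (U j) y) adm).
by rewrite /along !partial_ray_potential !dW !dY.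
Qed.

End RayPotential.

Lemma potential_null (f : 'rV[R]_2 -> tensor4 R 2)
    (v : 'rV[R]_2 -> 'M[R]_2) (u : 'rV[R]_2 -> 'rV[R]_2) :
  (forall i j k l, rapid (fun x => f x i j k l)) ->
  (forall x, elastic2 (f x)) ->
  (forall i j, smooth (fun x => v x i j) /\ vanishing_derivatives (fun x => v x i j)) ->
  (forall i, smooth (fun x => u x 0 i) /\ vanishing_derivatives (fun x => u x 0 i)) ->
  (forall x i j k l, f x i j k l = H v x i j k l + K u x i j k l) ->
  forall x xi zeta, admissible xi zeta -> elastic_ray_transform f x xi zeta = 0.
Proof.
move=> rf ef vP uP fHK x xi zeta [/enorm1_dotv xi1 adm].
have xi0 : 0 < dotv xi xi by rewrite xi1.
pose Phi := ray_potential (fun k l y => v y k l) (fun j y => u y 0 j) xi zeta.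
have sV k l : smooth (fun y => v y k l) by have [] := vP k l.
have tV k l : vanishing_derivatives (fun y => v y k l) by have [] := vP k l.
have sU j : smooth (fun y => u y 0 j) by have [] := uP j.
have tU j : vanishing_derivatives (fun y => u y 0 j) by have [] := uP j.
have sPhi : smooth Phi := smooth_ray_potential xi zeta sV sU.
have tPhi : tends_to_0_at_infinity Phi.
  by apply: ray_potential_tends_to_0; [exact: sV|exact: tV|exact: tU].
have key y : along xi Phi y = contract (f y) xi zeta.
  have E := @along_ray_potential _ _ xi zeta sV sU y adm.
  apply: (etrans E); congr contract.
  by apply/funext => i; apply/funext => j; apply/funext => k; apply/funext => l; rewrite fHK.
have dPhi (t : R) : is_derive t 1 (fun t => Phi (x + t *: xi)) (contract (f (x + t *: xi)) xi zeta).
  by rewrite -key; exact: is_derive_line.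
have rc := rapid_contract xi zeta rf ef.
apply: (@Rintegral_setT_eq0 R (fun t => contract (f (x + t *: xi)) xi zeta) _
  (rapid_line_dominated x rc xi0) dPhi).
- exact: tends_to_0_line.
- apply/cvgNy_compNP.
  have -> : (fun t => Phi (x + t *: xi)) \o -%R = fun t : R => Phi (x + t *: - xi).
    by apply/funext => t /=; rewrite scalerN scaleNr.
  by apply: tends_to_0_line => //; rewrite dotvN.
Qed.

End PotentialsAreNull.

(** * Recovering the potentials *)

Section Potentials.
Context {R : realType}.
Implicit Types (x e xi zeta : 'rV[R]_2) (g h s t b w : 'rV[R]_2 -> R) (i : 'I_2).

Lemma rapid_lincomb (a c : R) g h : rapid g -> rapid h ->
  rapid (fun x => a * g x + c * h x).
Proof. by move=> rg rh; exact: rapidD (rapidZ a rg) (rapidZ c rh). Qed.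

Lemma along_along xi zeta g x : smooth g -> along xi (along zeta g) x =
  xi 0 0 * (zeta 0 0 * partial 0 (partial 0 g) x + zeta 0 1 * partial 0 (partial 1 g) x) +
  xi 0 1 * (zeta 0 0 * partial 0 (partial 1 g) x + zeta 0 1 * partial 1 (partial 1 g) x).
Proof.
move=> sg; have s0 := smooth_partial 0 sg; have s1 := smooth_partial 1 sg.
rewrite (partialC 0 1 sg) {1}/along.
have E i := partials_lincomb (zeta 0 0) (zeta 0 1) [:: i] s0 s1.
rewrite -[partial 0 (along zeta g)]/(partials [:: 0] (along zeta g)).
rewrite -[partial 1 (along zeta g)]/(partials [:: 1] (along zeta g)).
by rewrite !E /= (partialC 0 1 sg).
Qed.

Lemma along_delta i g x : along 'e_i g x = partial i g x.
Proof.
rewrite /along !mxE; have [->|->] := ord2P i => /=.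
  by rewrite mul1r mul0r addr0.
by rewrite mul1r mul0r add0r.
Qed.

Lemma partial_antiderivative i h : rapid h -> line_null 'e_i h ->
  exists2 w, rapid w & forall x, partial i w x = h x.
Proof.
move=> rh n; have [w [rw wE _]] := antiderivative rh (dotv_delta i) n.
by exists w => // x; rewrite -along_delta.
Qed.

Lemma along_along_antiderivative xi zeta h : rapid h ->
  dotv xi xi = 1 -> dotv zeta zeta = 1 -> dotv xi zeta = 0 ->
  line_null xi h -> line_null zeta h ->
  exists2 g, rapid g & forall x, along xi (along zeta g) x = h x.
Proof.
move=> rh x1 z1 xz nx nz; have [p [rp pE pn]] := antiderivative rh x1 nx.
have [g [rg gE _]] := antiderivative rp z1 (pn _ z1 xz nz).
exists g => // x; rewrite -pE; congr (along xi _ x).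
by apply/funext => y; exact: gE.
Qed.

Lemma mixed_antiderivative h : rapid h -> line_null 'e_0 h -> line_null 'e_1 h ->
  exists2 t, rapid t & forall x, partial 0 (partial 1 t) x = h x.
Proof.
move=> rh n0 n1.
have [t rt tE] :=
  along_along_antiderivative rh (dotv_delta 0) (dotv_delta 1) dotv_delta01 n0 n1.
exists t => // x; rewrite -tE along_delta.
by congr (partial 0 _ x); apply/funext => y; rewrite along_delta.
Qed.

(** Unit vectors along the two diagonals. *)
Definition diag_p : 'rV[R]_2 := (Num.sqrt 2)^-1 *: ('e_0 + 'e_1).
Definition diag_m : 'rV[R]_2 := (Num.sqrt 2)^-1 *: ('e_1 - 'e_0).

Lemma diagE : ((diag_p 0 0 = (Num.sqrt 2)^-1) * (diag_p 0 1 = (Num.sqrt 2)^-1)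
  * (diag_m 0 0 = - (Num.sqrt 2)^-1) * (diag_m 0 1 = (Num.sqrt 2)^-1))%type.
Proof.
rewrite !mxE /= !(subr0, addr0, add0r, sub0r, mulr1, mulrN1); do !split.
Qed.

Lemma sqrt2V2 : (Num.sqrt 2 : R)^-1 * (Num.sqrt 2)^-1 = 2^-1.
Proof. by rewrite -invfM -expr2 sqr_sqrtr. Qed.

Lemma dotv_diag : ((dotv diag_p diag_p = 1) * (dotv diag_m diag_m = 1)
  * (dotv diag_p diag_m = 0))%type.
Proof.
by rewrite !dotvE !diagE !(mulrN, mulNr) ?opprK sqrt2V2; do !split; field.
Qed.

(** In the coordinates along the diagonals, the wave operator is a mixed
    derivative. *)
Lemma wave_antiderivative h : rapid h -> line_null diag_p h -> line_null diag_m h ->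
  exists2 s, rapid s & forall x, partial 1 (partial 1 s) x - partial 0 (partial 0 s) x = h x.
Proof.
move=> rh np nm.
have [g rg gE] := along_along_antiderivative rh dotv_diag.1.1 dotv_diag.1.2 dotv_diag.2 np nm.
have [sg _] := rg.
exists (fun x => 2^-1 * g x); first exact: rapidZ.
move=> x.
have E i j : partial i (partial j (fun x => 2^-1 * g x)) x = 2^-1 * partial i (partial j g) x.
  have := partialsZ 2^-1 [:: i; j] sg => Es.
  by rewrite -[partial i (partial j _)]/(partials [:: i; j] (fun x => 2^-1 * g x)) Es.
rewrite (E 0 0) (E 1 1) -gE (along_along _ _ _ sg) !diagE.
move: (partial 0 (partial 0 g) x) (partial 0 (partial 1 g) x) (partial 1 (partial 1 g) x) => a b c.
have := sqrt2V2; move: (Num.sqrt 2)^-1 => r r2.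
have -> : r * (- r * a + r * b) + r * (- r * b + r * c) = (r * r) * (c - a) by ring.
by rewrite r2; ring.
Qed.

Lemma line_null_cancel e k g : rapid g -> dotv e e = 1 -> k != 0 ->
  line_null e (fun x => k * g x) -> line_null e g.
Proof.
move=> rg e1 k0 n.
rewrite (_ : g = fun x => k^-1 * (k * g x)); last first.
  by apply/funext => x; rewrite mulKf.
exact: line_nullZ (rapidZ k rg) e1 n.
Qed.

(** Rotation by a right angle. *)
Definition rot xi : 'rV[R]_2 := (- xi 0 1) *: 'e_0 + xi 0 0 *: 'e_1.

Lemma rotE xi : ((rot xi 0 0 = - xi 0 1) * (rot xi 0 1 = xi 0 0))%type.
Proof. by rewrite !mxE /= !(mulr1, mulr0) addr0 add0r. Qed.

Lemma dotv_rot xi : dotv xi (rot xi) = 0.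
Proof. by rewrite dotvE !rotE; ring. Qed.

(** The quartic below minus the second derivative of [p s + m t] along [xi] and
    [rot xi] is [p m] times the difference of the two sides of the conclusion. *)
Lemma shear_compatibility s t b : rapid s -> rapid t -> rapid b ->
  (forall xi, dotv xi xi = 1 -> line_null xi (fun x =>
     let p := xi 0 0 * xi 0 1 in let m := xi 0 0 ^+ 2 - xi 0 1 ^+ 2 in
     p ^+ 2 * (partial 1 (partial 1 s) x - partial 0 (partial 0 s) x)
     + p * m * b x + m ^+ 2 * partial 0 (partial 1 t) x)) ->
  forall x, b x = partial 1 (partial 1 t) x - partial 0 (partial 0 t) x
                  + partial 0 (partial 1 s) x.
Proof.
move=> rs rt rb n.
have rpp g i j : rapid g -> rapid (partial i (partial j g)).
  by move=> rg; exact: rapid_partial (rapid_partial j rg).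
pose r x := 1 * b x + -1 * (1 * (1 * partial 1 (partial 1 t) x + -1 * partial 0 (partial 0 t) x)
   + 1 * partial 0 (partial 1 s) x).
have rr : rapid r.
  apply: (rapid_lincomb 1 (-1) rb).
  apply: (rapid_lincomb 1 1 _ (rpp s 0 1 rs)).
  exact: (rapid_lincomb 1 (-1) (rpp t 1 1 rt) (rpp t 0 0 rt)).
suff r0 : forall x, r x = 0.
  move=> x; have := r0 x; rewrite /r.
  move: (partial 1 (partial 1 t) x) (partial 0 (partial 0 t) x)
    (partial 0 (partial 1 s) x) (b x) => p q k d.
  by rewrite !mul1r !mulN1r => /eqP; rewrite subr_eq0 => /eqP.
apply: (ray_injective rr) => xi xi1 pm0.
apply: (line_null_cancel rr xi1 pm0).
set p := xi 0 0 * xi 0 1; set m := xi 0 0 ^+ 2 - xi 0 1 ^+ 2.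
pose V x := p * s x + m * t x.
have rV : rapid V by exact: rapid_lincomb.
have nV := line_null_along (rapid_along (rot xi) rV) xi1.
have sV i j := partials_lincomb p m [:: i; j] (rapid_smooth rs) (rapid_smooth rt).
have dV i j x : partial i (partial j V) x =
    p * partial i (partial j s) x + m * partial i (partial j t) x.
  by rewrite -[partial i (partial j V)]/(partials [:: i; j] V) sV.
pose Q x := p ^+ 2 * (partial 1 (partial 1 s) x - partial 0 (partial 0 s) x)
     + p * m * b x + m ^+ 2 * partial 0 (partial 1 t) x.
have nQ : line_null xi Q := n xi xi1.
have E : (fun x => p * m * r x) = fun x => Q x + -1 * along xi (along (rot xi) V) x.
  apply/funext => x.
  rewrite (along_along xi (rot xi) x (rapid_smooth rV)) (dV 0 0) (dV 0 1) (dV 1 1) !rotE.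
  rewrite /r /Q /p /m.
  move: (partial 0 (partial 0 s) x) (partial 0 (partial 1 s) x) (partial 1 (partial 1 s) x)
    (partial 0 (partial 0 t) x) (partial 0 (partial 1 t) x) (partial 1 (partial 1 t) x) (b x).
  move=> s00 s01 s11 t00 t01 t11 d; ring.
have rQ : rapid Q.
  have EQ : Q = fun x => 1 * (p ^+ 2 * (1 * partial 1 (partial 1 s) x + -1 * partial 0 (partial 0 s) x)
     + p * m * b x) + m ^+ 2 * partial 0 (partial 1 t) x.
    by apply/funext => x; rewrite /Q !mul1r mulN1r.
  rewrite EQ; apply: (rapid_lincomb 1 (m ^+ 2) _ (rpp t 0 1 rt)).
  apply: (rapid_lincomb (p ^+ 2) (p * m) _ rb).
  exact: (rapid_lincomb 1 (-1) (rpp s 1 1 rs) (rpp s 0 0 rs)).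
have raa := rapid_along xi (rapid_along (rot xi) rV).
rewrite [X in line_null _ X]E.
exact: line_nullD rQ (rapidZ (-1) raa) xi1 nQ (line_nullZ (-1) raa xi1 nV).
Qed.

(** The quadratic form below minus the derivative of [<xi, w>] along [xi] is
    [xi_0 xi_1] times the difference of the two sides of the conclusion. *)
Lemma gradient_compatibility (w0 w1 b : 'rV[R]_2 -> R) : rapid w0 -> rapid w1 -> rapid b ->
  (forall xi, dotv xi xi = 1 -> line_null xi (fun x =>
     xi 0 0 ^+ 2 * partial 0 w0 x + xi 0 0 * xi 0 1 * b x + xi 0 1 ^+ 2 * partial 1 w1 x)) ->
  forall x, b x = partial 0 w1 x + partial 1 w0 x.
Proof.
move=> r0 r1 rb n.
pose r x := 1 * b x + -1 * (1 * partial 0 w1 x + 1 * partial 1 w0 x).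
have rr : rapid r.
  apply: (rapid_lincomb 1 (-1) rb).
  exact: (rapid_lincomb 1 1 (rapid_partial 0 r1) (rapid_partial 1 r0)).
suff rN : forall x, r x = 0.
  move=> x; have := rN x; rewrite /r.
  move: (partial 0 w1 x) (partial 1 w0 x) (b x) => p q k.
  by rewrite !mul1r !mulN1r => /eqP; rewrite subr_eq0 => /eqP.
apply: (ray_injective rr) => xi xi1 pm0.
have p0 : xi 0 0 * xi 0 1 != 0 by apply: contraNneq pm0 => ->; rewrite mul0r.
apply: (line_null_cancel rr xi1 p0).
pose V x := xi 0 0 * w0 x + xi 0 1 * w1 x.
have rV : rapid V by exact: rapid_lincomb.
have nV := line_null_along rV xi1.
have sV i := partials_lincomb (xi 0 0) (xi 0 1) [:: i] (rapid_smooth r0) (rapid_smooth r1).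
have dV i x : partial i V x = xi 0 0 * partial i w0 x + xi 0 1 * partial i w1 x.
  by rewrite -[partial i V]/(partials [:: i] V) sV.
pose Q x := xi 0 0 ^+ 2 * partial 0 w0 x + xi 0 0 * xi 0 1 * b x + xi 0 1 ^+ 2 * partial 1 w1 x.
have nQ : line_null xi Q := n xi xi1.
have E : (fun x => xi 0 0 * xi 0 1 * r x) = fun x => Q x + -1 * along xi V x.
  apply/funext => x; rewrite /along (dV 0) (dV 1) /r /Q.
  move: (partial 0 w0 x) (partial 0 w1 x) (partial 1 w0 x) (partial 1 w1 x) (b x).
  move=> a c d k l; ring.
have rQ : rapid Q.
  have EQ : Q = fun x => 1 * (xi 0 0 ^+ 2 * partial 0 w0 x + xi 0 0 * xi 0 1 * b x)
     + xi 0 1 ^+ 2 * partial 1 w1 x.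
    by apply/funext => x; rewrite /Q !mul1r.
  rewrite EQ; apply: (rapid_lincomb 1 _ _ (rapid_partial 1 r1)).
  exact: (rapid_lincomb _ _ (rapid_partial 0 r0) rb).
have raa := rapid_along xi rV.
rewrite [X in line_null _ X]E.
exact: line_nullD rQ (rapidZ (-1) raa) xi1 nQ (line_nullZ (-1) raa xi1 nV).
Qed.

End Potentials.

Section Recovery.
Context {R : realType}.
Implicit Types (x xi zeta : 'rV[R]_2).

(** The algebraic identity behind the choice of the potentials. Here [S] and [T]
    stand for the second derivatives of [s] and [t], where [v] has diagonal
    entries [- s / 2], [s / 2] and off-diagonal entry [t]; [W0] and [W1] stand for
    the first derivatives of the components of [w = u + div v]; and [V] and [U]
    for the second derivatives of [v] and the first derivatives of [u]. *)
Lemma elastic_decomposition (w : tensor4 R 2) (S T : 'I_2 -> 'I_2 -> R) (W0 W1 : 'I_2 -> R) :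
  elastic2 w -> S 1 0 = S 0 1 -> T 1 0 = T 0 1 ->
  T 0 1 = w 0 1 0 1 ->
  S 1 1 - S 0 0 = w 0 0 0 0 + w 1 1 1 1 - 2 * w 0 0 1 1 ->
  2 * (w 0 1 1 1 - w 0 0 0 1) = T 1 1 - T 0 0 + S 0 1 ->
  W0 0 = w 0 0 0 0 + w 0 1 0 1 -> W1 1 = w 1 1 1 1 + w 0 1 0 1 ->
  2 * (w 0 0 0 1 + w 0 1 1 1) = W1 0 + W0 1 ->
  forall i j k l, w i j k l =
    let V i j k l := if k == l then (if k == 0 then - 2^-1 else 2^-1) * S i j else T i j in
    let U i j := if j == 0 then W0 i + 2^-1 * S i 0 - T i 1 else W1 i - T i 0 - 2^-1 * S i 1 in
    2^-1 * (V i j k l + V k l i j)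
    + (4^-1 * (U i j + U j i) * (k == l)%:R + 4^-1 * (U l k + U k l) * (i == j)%:R).
Proof.
move=> ew S10 T10 e1 e2 e3 e4 e5 e6 i j k l.
have [->|->] := ord2P i; have [->|->] := ord2P j; have [->|->] := ord2P k;
  have [->|->] := ord2P l; rewrite /= ?(elastic2E ew) ?S10 ?T10; lra.
Qed.

Lemma null_potential (f : 'rV[R]_2 -> tensor4 R 2) :
  (forall i j k l, rapid (fun x => f x i j k l)) ->
  (forall x, elastic2 (f x)) ->
  (forall x xi zeta, admissible xi zeta -> elastic_ray_transform f x xi zeta = 0) ->
  exists (v : 'rV[R]_2 -> 'M[R]_2) (u : 'rV[R]_2 -> 'rV[R]_2),
    [/\ forall x, symmetric2 (v x), forall i j, rapid (fun x => v x i j),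
      forall i, rapid (fun x => u x 0 i) &
      forall x i j k l, f x i j k l = H v x i j k l + K u x i j k l].
Proof.
move=> rf ef nf.
have nP xi : dotv xi xi = 1 -> line_null xi (fun x => contract (f x) xi xi).
  move=> x1 x; apply: nf; split; first exact: dotv1_enorm.
  by left; exists 1; rewrite scale1r.
have nS xi zeta : dotv xi xi = 1 -> dotv xi zeta = 0 ->
    line_null xi (fun x => contract (f x) xi zeta).
  by move=> x1 xz x; apply: nf; split; [exact: dotv1_enorm|right].
pose A x := f x 0 0 0 0; pose B x := f x 0 0 0 1; pose C x := f x 0 0 1 1.
pose D x := f x 0 1 0 1; pose E x := f x 0 1 1 1; pose G x := f x 1 1 1 1.
have rA : rapid A by exact: rf. have rB : rapid B by exact: rf.
have rC : rapid C by exact: rf. have rD : rapid D by exact: rf.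
have rE : rapid E by exact: rf. have rG : rapid G by exact: rf.
have nE xi zeta g : (forall x, contract (f x) xi zeta = g x) ->
    line_null xi (fun x => contract (f x) xi zeta) -> line_null xi g.
  by move=> /funext ->.
(* the shear part along the axes *)
have nD0 : line_null 'e_0 D.
  apply: nE (nS _ 'e_1 (dotv_delta 0) dotv_delta01) => x.
  by rewrite contractE// !mxE /= /D; ring.
have nD1 : line_null 'e_1 D.
  apply: nE (nS _ 'e_0 (dotv_delta 1) dotv_delta10) => x.
  by rewrite contractE// !mxE /= /D; ring.
(* the pressure part along the axes *)
have nA : line_null 'e_0 A.
  apply: nE (nP _ (dotv_delta 0)) => x.
  by rewrite contractE// !mxE /= /A; ring.
have nG : line_null 'e_1 G.
  apply: nE (nP _ (dotv_delta 1)) => x.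
  by rewrite contractE// !mxE /= /G; ring.
(* the shear part along the diagonals *)
pose al x := 1 * (1 * A x + 1 * G x) + -2 * C x.
have ral : rapid al by exact: rapid_lincomb (rapid_lincomb 1 1 rA rG) rC.
have d4 : (4^-1 : R) != 0 by rewrite invr_eq0.
have nalp : line_null diag_p al.
  apply: (line_null_cancel ral dotv_diag.1.1 d4).
  apply: nE (nS _ diag_m dotv_diag.1.1 dotv_diag.2) => x.
  by rewrite contractE// !diagE /= !(mulrN, mulNr) !sqrt2V2 /al /A /C /G; field.
have nalm : line_null diag_m al.
  apply: (line_null_cancel ral dotv_diag.1.2 d4).
  have dmp : dotv (diag_m : 'rV[R]_2) diag_p = 0 by rewrite -dotv_diag.2 !dotvE; ring.
  apply: nE (nS _ diag_p dotv_diag.1.2 dmp) => x.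
  by rewrite contractE// !diagE /= !(mulrN, mulNr) !sqrt2V2 /al /A /C /G; field.
have [t rt tE] := mixed_antiderivative rD nD0 nD1.
have [s rs sE] := wave_antiderivative ral nalp nalm.
(* the shear part in the remaining directions *)
pose be x := 2 * E x + -2 * B x.
have rbe : rapid be by exact: rapid_lincomb.
have beE : forall x, be x = partial 1 (partial 1 t) x - partial 0 (partial 0 t) x
    + partial 0 (partial 1 s) x.
  apply: (shear_compatibility rs rt rbe) => xi xi1.
  apply: nE (nS xi (rot xi) xi1 (dotv_rot xi)) => x.
  by rewrite contractE// !rotE /= sE tE /be /al /A /B /C /D /E /G; ring.
(* the sum of the two parts *)
have [w0 rw0 w0E] := partial_antiderivative (rapidD rA rD)
  (line_nullD rA rD (dotv_delta 0) nA nD0).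
have [w1 rw1 w1E] := partial_antiderivative (rapidD rG rD)
  (line_nullD rG rD (dotv_delta 1) nG nD1).
pose b2 x := 2 * B x + 2 * E x.
have rb2 : rapid b2 by exact: rapid_lincomb.
have b2E : forall x, b2 x = partial 0 w1 x + partial 1 w0 x.
  apply: (gradient_compatibility rw0 rw1 rb2) => xi xi1.
  have n2 := line_nullD (rapid_contract xi xi rf ef) (rapid_contract xi (rot xi) rf ef)
    xi1 (nP xi xi1) (nS xi (rot xi) xi1 (dotv_rot xi)).
  move=> x; rewrite -[RHS](n2 x); apply: eq_Rintegral => a _.
  move: (x + a *: xi) => y; rewrite w0E w1E !contractE// !rotE /=.
  (* make both sides homogeneous of degree four, using [|xi|^2 = 1] *)
  by rewrite -[LHS]mul1r -[X in X * _ = _]xi1 dotvE /b2 /A /B /D /E /G; ring.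
pose c (k : 'I_2) : R := if k == 0 then - 2^-1 else 2^-1.
pose v x : 'M[R]_2 := \matrix_(k, l) (if k == l then c k * s x else t x).
pose u x : 'rV[R]_2 := \row_j (if j == 0 then
    1 * (1 * w0 x + 2^-1 * partial 0 s x) + -1 * partial 1 t x
  else 1 * (1 * w1 x + -1 * partial 0 t x) + - 2^-1 * partial 1 s x).
have vE k l : (fun x => v x k l) = if k == l then (fun x => c k * s x) else t.
  by apply/funext => x; rewrite mxE; case: (k == l).
pose a0 x := 1 * w0 x + 2^-1 * partial 0 s x.
pose a1 x := 1 * w1 x + -1 * partial 0 t x.
have ra0 : rapid a0 := rapid_lincomb 1 2^-1 rw0 (rapid_partial 0 rs).
have ra1 : rapid a1 := rapid_lincomb 1 (-1) rw1 (rapid_partial 0 rt).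
have uE j : (fun x => u x 0 j) = if j == 0 then (fun x => 1 * a0 x + -1 * partial 1 t x)
    else (fun x => 1 * a1 x + - 2^-1 * partial 1 s x).
  by apply/funext => x; rewrite mxE; case: (j == 0).
exists v, u; split.
- by move=> x i j; rewrite !mxE eq_sym; case: eqP => // ->.
- by move=> i j; rewrite vE; case: (i == j) => //; exact: rapidZ.
- move=> i; rewrite uE; case: (i == 0).
    exact: rapid_lincomb ra0 (rapid_partial 1 rt).
  exact: rapid_lincomb ra1 (rapid_partial 1 rs).
move=> x i j k l.
have cs := partialC 1 0 (rapid_smooth rs); have ct := partialC 1 0 (rapid_smooth rt).
have Vv i' j' k' l' : partial i' (partial j' (fun y => v y k' l')) x =
    if k' == l' then c k' * partial i' (partial j' s) x else partial i' (partial j' t) x.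
  rewrite (vE k' l'); case: (k' == l'); last by reflexivity.
  exact: (congr1 (fun h => h x) (partialsZ (c k') [:: i'; j'] (rapid_smooth rs))).
have Uu i' j' : partial i' (fun y => u y 0 j') x = if j' == 0
    then partial i' w0 x + 2^-1 * partial i' (partial 0 s) x - partial i' (partial 1 t) x
    else partial i' w1 x - partial i' (partial 0 t) x - 2^-1 * partial i' (partial 1 s) x.
  have l0 : partial i' a0 x = 1 * partial i' w0 x + 2^-1 * partial i' (partial 0 s) x :=
    congr1 (fun h => h x) (partials_lincomb 1 2^-1 [:: i']
      (rapid_smooth rw0) (rapid_smooth (rapid_partial 0 rs))).
  have l1 : partial i' a1 x = 1 * partial i' w1 x + -1 * partial i' (partial 0 t) x :=
    congr1 (fun h => h x) (partials_lincomb 1 (-1) [:: i']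
      (rapid_smooth rw1) (rapid_smooth (rapid_partial 0 rt))).
  have l2 : partial i' (fun y => 1 * a0 y + -1 * partial 1 t y) x
      = 1 * partial i' a0 x + -1 * partial i' (partial 1 t) x :=
    congr1 (fun h => h x) (partials_lincomb 1 (-1) [:: i']
      (rapid_smooth ra0) (rapid_smooth (rapid_partial 1 rt))).
  have l3 : partial i' (fun y => 1 * a1 y + - 2^-1 * partial 1 s y) x
      = 1 * partial i' a1 x + - 2^-1 * partial i' (partial 1 s) x :=
    congr1 (fun h => h x) (partials_lincomb 1 (- 2^-1) [:: i']
      (rapid_smooth ra1) (rapid_smooth (rapid_partial 1 rs))).
  rewrite (uE j'); case: (j' == 0).
    by rewrite l2 l0 mul1r mulN1r mul1r.
  by rewrite l3 l1 mul1r mulN1r mul1r mulNr.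
have q := @elastic_decomposition (f x) (fun i j => partial i (partial j s) x)
  (fun i j => partial i (partial j t) x) (fun i => partial i w0 x) (fun i => partial i w1 x) (ef x).
rewrite /H /K !Vv !Uu; apply: q.
- by rewrite cs.
- by rewrite ct.
- exact: tE.
- by rewrite sE /al /A /C /G; ring.
- by rewrite -beE /be /B /E; ring.
- exact: w0E.
- exact: w1E.
- by rewrite -b2E /b2 /B /E; ring.
Qed.

End Recovery.

Theorem theorem11 (R : realType) (f : 'rV[R]_2 -> tensor4 R 2)
    (f_elastic : forall x, elastic2 (f x))
    (f_schwartz : forall i j k l, schwartz (fun x => f x i j k l)) :
  (forall x xi zeta : 'rV[R]_2,
     admissible xi zeta -> elastic_ray_transform f x xi zeta = 0)
  <->
  (exists (v : 'rV[R]_2 -> 'M[R]_2) (u : 'rV[R]_2 -> 'rV[R]_2),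
     (forall x, symmetric2 (v x)) /\
     (forall i j, smooth (fun x => v x i j)
                  /\ vanishing_derivatives (fun x => v x i j)) /\
     (forall i, smooth (fun x => u x 0 i)
                /\ vanishing_derivatives (fun x => u x 0 i)) /\
     (forall x i j k l, f x i j k l = H v x i j k l + K u x i j k l)).
Proof.
have rf i j k l : rapid (fun x => f x i j k l) by exact: schwartz_rapid.
split=> [nf|[v [u [_ [vP [uP E]]]]]]; last exact: (potential_null rf f_elastic vP uP E).
have [v [u [sv rv ru E]]] := null_potential rf f_elastic nf.
exists v, u; split=> //; split; last split=> //.
  by move=> i j; split; [exact: rapid_smooth|exact: rapid_vanishing].
by move=> i; split; [exact: rapid_smooth|exact: rapid_vanishing].
Qed.
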